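(* Let $p$ be an integer with $6\le p\le 10$, and let $\lambda_1\le\lambda_2\le\lambda_3\le\cdots$ be the length spectrum of the triangle group $\Gamma(2,p,\infty)$, listed in nondecreasing order with multiplicity. Then $$\lambda_1=\lambda_2=2\,\mathrm{arccosh}\Big(2\cos\tfrac{\pi}{p}\Big)\;<\;\lambda_3=2\,\mathrm{arccosh}\Big(4\cos^2\tfrac{\pi}{p}-1\Big).$$
   Context: Let $\mathbf H$ be the hyperbolic plane with its distance $d$. Let $T$ be a hyperbolic triangle with angles $\pi/2,\pi/p,0$ (the last vertex being ideal); the triangle group $\Gamma(2,p,\infty)$ is the group of orientation-preserving elements of the group generated by the reflections in the sides of $T$. For a hyperbolic element $\gamma$ its length is $l(\gamma)=\inf\{d(x,\gamma x): x\in\mathbf H\}$. The length spectrum is the family of the numbers $l(\gamma)$ as $\gamma$ runs over the $\Gamma(2,p,\infty)$-conjugacy classes of hyperbolic elements of $\Gamma(2,p,\infty)$, each conjugacy class contributing one entry. *)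

(* Defs.v *)
From HB Require Import structures.
From mathcomp Require Import all_boot all_order all_algebra.
From mathcomp Require Import all_classical all_reals all_analysis.

Set Implicit Arguments.
Unset Strict Implicit.
Unset Printing Implicit Defensive.

Import Order.TTheory GRing.Theory Num.Theory.

Local Open Scope classical_set_scope.
Local Open Scope ring_scope.

(* The hyperbolic plane is the hyperboloid model: the upper sheet of
   <x, x> = -1 for the Lorentz form on R^3, with cosh d(x, y) = - <x, y>.
   Isometries of the plane are represented by the 3x3 matrices that induce
   them; the representation is faithful since the sheet spans R^3. *)

Section HyperbolicPlane.
Variable R : realType.

(* Meaningful for 1 <= x. *)
Definition arccosh (x : R) : R := ln (x + Num.sqrt (x ^+ 2 - 1)).

Definition lorentz (x y : 'cV[R]_3) : R :=
  x 1 0 * y 1 0 + x 2 0 * y 2 0 - x 0 0 * y 0 0.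

Definition hyperbolic_plane : set 'cV[R]_3 :=
  [set x | lorentz x x = -1 /\ 0 < x 0 0].

Definition hdist (x y : 'cV[R]_3) : R := arccosh (- lorentz x y).

(* Points of the circle at infinity are the rays of the future light cone;
   a vector of this set represents the ray it spans. *)
Definition ideal : set 'cV[R]_3 := [set v | lorentz v v = 0 /\ 0 < v 0 0].

Definition same_ideal (v w : 'cV[R]_3) : Prop := exists t : R, v = t *: w.

(* Tangent vector at X (Lorentz-orthogonal to X) of the geodesic from X
   towards Y, where Y is a point of the plane or an ideal point. *)
Definition tangent (X Y : 'cV[R]_3) : 'cV[R]_3 := Y + lorentz X Y *: X.

Definition angle (Y X Z : 'cV[R]_3) : R :=
  let u := tangent X Y in
  let v := tangent X Z in
  acos (lorentz u v / (Num.sqrt (lorentz u u) * Num.sqrt (lorentz v v))).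

(* Triangle with vertices A, B and ideal vertex C, with angle a at A and b
   at B; the angle at an ideal vertex is 0 by convention. *)
Definition triangle_with_angles (a b : R) (A B C : 'cV[R]_3) : Prop :=
  [/\ hyperbolic_plane A, hyperbolic_plane B, ideal C & A <> B] /\
  (angle B A C = a /\ angle A B C = b).

(* Matrix of x |-> x - 2 <x, n> n: for a unit spacelike n, the reflection in
   the geodesic of points orthogonal to n. *)
Definition reflection (n : 'cV[R]_3) : 'M[R]_3 :=
  \matrix_(i, j) ((i == j)%:R - 2 * lorentz (delta_mx j 0) n * n i 0).

(* A singleton when X, Y are linearly independent: the unit normal n of the
   geodesic through X and Y is unique up to sign. *)
Definition reflections_through (X Y : 'cV[R]_3) : set 'M[R]_3 :=
  [set reflection n | n in
    [set n | [/\ lorentz n n = 1, lorentz n X = 0 & lorentz n Y = 0]]].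

Definition is_subgroup (G : set 'M[R]_3) : Prop :=
  [/\ forall g, G g -> g \in unitmx,
      G 1%:M,
      forall g h, G g -> G h -> G (g *m h)
    & forall g, G g -> G (invmx g)].

Definition generated_group (S : set 'M[R]_3) : set 'M[R]_3 :=
  smallest is_subgroup S.

(* A linear isometry of the Lorentz form that preserves the upper sheet
   preserves the orientation of the sheet iff its determinant is positive. *)
Definition orientation_preserving (g : 'M[R]_3) : Prop := 0 < \det g.

Definition triangle_group (A B C : 'cV[R]_3) : set 'M[R]_3 :=
  generated_group (reflections_through A B `|` reflections_through B C
                   `|` reflections_through C A)
  `&` orientation_preserving.

Definition fixes_ideal (g : 'M[R]_3) (v : 'cV[R]_3) : Prop :=
  same_ideal (g *m v) v.

(* For orientation-preserving isometries: exactly two fixed points on the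
   circle at infinity. *)
Definition hyperbolic (g : 'M[R]_3) : Prop :=
  exists v w : 'cV[R]_3,
    [/\ ideal v, ideal w, ~ same_ideal v w
      & forall u, ideal u ->
          (fixes_ideal g u <-> same_ideal u v \/ same_ideal u w)].

Definition hlength (g : 'M[R]_3) : R :=
  inf [set hdist x (g *m x) | x in hyperbolic_plane].

Definition conj_class (G : set 'M[R]_3) (g : 'M[R]_3) : set 'M[R]_3 :=
  [set h *m g *m invmx h | h in G].

Definition hyperbolic_classes (G : set 'M[R]_3) : set (set 'M[R]_3) :=
  [set conj_class G g | g in G `&` hyperbolic].

(* lam 0 <= lam 1 <= ... enumerates the lengths of the hyperbolic conjugacy
   classes of G, each class contributing exactly one index. *)
Definition is_length_spectrum (G : set 'M[R]_3) (lam : nat -> R) : Prop :=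
  {homo lam : m n / (m <= n)%N >-> m <= n} /\
  exists c : nat -> set 'M[R]_3,
    set_bij [set: nat] (hyperbolic_classes G) c /\
    forall n g, c n g -> lam n = hlength g.

End HyperbolicPlane.

(* Main.v *)
Require Import Defs.
From mathcomp Require Import all_boot all_order all_algebra.
From mathcomp Require Import all_classical all_reals all_analysis.
From mathcomp Require Import ring lra zify.
Import Order.TTheory GRing.Theory Num.Theory.
Local Open Scope ring_scope.

Set Implicit Arguments.
Unset Strict Implicit.
Unset Printing Implicit Defensive.

(** The angles of the triangle determine the Gram matrix of its vertices, so
    the plane can be identified with the space of positive definite symmetric
    two by two matrices of determinant one in such a way that the vertices are
    [i], [e ^ (i theta)] and infinity, with [theta = pi / p]
    ([triangle_frame]). On symmetric matrices a matrix [M] acts by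
    [S |-> M S M^T], and the triangle group becomes the group generated, up to
    signs, by the rotation [U] of order two about [i] and a rotation [V] of
    order [p] ([triangle_groupP]).

    If [det M = 1], the displacement of a point [S] is given by
    [tr M ^ 2 / 2 - 1] plus half the square of a linear form in [S]
    ([displacement]). Hence [M] is hyperbolic only if [tr M ^ 2 > 4], the
    length is then at least [arccosh (tr M ^ 2 / 2 - 1)], that is
    [2 arccosh (|tr M| / 2)], and equality is checked for the words
    [U V ^ k], whose axes are explicit.

    Every element is conjugate to [1], [U], [V ^ b] or a product of syllables
    [U V ^ k] with [0 < k < p] ([word_reduce]). Up to sign, the syllable
    [U V ^ k] has the nonnegative entries [s_k], [s_(k + 1)], [s_(k - 1)],
    [s_k], where [s_k = sin (k theta) / sin theta]; it dominates the identity
    entrywise, so erasing syllables from a product lowers the trace. As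
    [tr (U V ^ k) = 2 s_k] up to sign, and [s_1 = 1], [s_2 = 2 cos theta],
    [s_3 = 4 cos theta ^ 2 - 1], this leaves the parabolic elements, the two
    words [U V ^ 2] and [U V ^ (p - 2)] of trace [2 s_2], and words of trace
    at least [2 s_3], a value attained by [U V ^ 3] ([positive_trace]).

    The same positivity shows that a word equal to the identity has exponent
    sum of [V] divisible by [p] ([wsum_ker]), so that [U V ^ 2] and
    [U V ^ (p - 2)] are not conjugate, as [p] does not divide [4]
    ([classes_neq]). Thus exactly two classes have the least length, and the
    class of [U V ^ 3] comes third. *)

(** * Sines and hyperbolic cosines *)

(** Outside [[-1, 1]] the inverse cosine takes its default value [0], so a
    positive value is always an honest one. *)
Lemma cos_of_acos (R : realType) (x a : R) : acos x = a -> 0 < a -> cos a = x.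
Proof.
rewrite unlock; case: xgetP => [y -> [] // _ yx <- //|_ <-].
by rewrite ltxx.
Qed.

Lemma sin_ltr (R : realType) (x y : R) :
  0 <= x -> x < y -> x + y < pi -> sin x < sin y.
Proof.
move=> x0 xy xypi; rewrite -subr_gt0.
have -> : sin y - sin x = 2 * cos ((y + x) / 2) * sin ((y - x) / 2).
  have -> : sin y = sin ((y + x) / 2 + (y - x) / 2) by congr sin; field.
  have -> : sin x = sin ((y + x) / 2 - (y - x) / 2) by congr sin; field.
  by rewrite sinD sinB; ring.
rewrite !mulr_gt0//.
- by apply: cos_gt0_pihalf; lra.
- by apply: sin_gt0_pi; lra.
Qed.

Lemma sin_ler (R : realType) (x y : R) :
  0 <= x -> x <= y -> x + y <= pi -> sin x <= sin y.
Proof.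
move=> x0; rewrite le_eqVlt => /orP[/eqP-> //|xy].
rewrite le_eqVlt => /orP[/eqP xypi|]; last by move=> h; exact/ltW/sin_ltr.
have -> : x = pi - y by lra.
by rewrite sinB sinpi cospi !mul0r mulN1r opprK add0r.
Qed.

Lemma sqr_gt1 (R : realType) (x : R) : 1 < x -> 1 < x ^+ 2.
Proof. by move=> x1; rewrite exprn_egt1. Qed.

Lemma ltr_arccosh (R : realType) (x y : R) :
  1 <= x -> x < y -> arccosh x < arccosh y.
Proof.
move=> x1 xy; have y1 : 1 < y by exact: le_lt_trans xy.
rewrite /arccosh ltr_ln ?posrE; try by apply: ltr_pwDl; [lra|exact: sqrtr_ge0].
apply: ltr_leD => //; rewrite ler_sqrt; last by rewrite subr_ge0 (ltW (sqr_gt1 y1)).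
rewrite lerD2r ler_sqr ?nnegrE; lra.
Qed.

Lemma ler_arccosh (R : realType) (x y : R) :
  1 <= x -> x <= y -> arccosh x <= arccosh y.
Proof.
move=> x1; rewrite le_eqVlt => /orP[/eqP-> //|xy].
exact/ltW/ltr_arccosh.
Qed.

(** Half-angle formula: [cosh (2 t) = 2 cosh t ^+ 2 - 1]. *)
Lemma arccosh_double (R : realType) (x : R) :
  1 <= x -> arccosh (2 * x ^+ 2 - 1) = 2 * arccosh x.
Proof.
move=> x1; rewrite /arccosh.
have x21 : 0 <= x ^+ 2 - 1 by rewrite subr_ge0 exprn_ege1.
have -> : (2 * x ^+ 2 - 1) ^+ 2 - 1 = (2 * x) ^+ 2 * (x ^+ 2 - 1) by ring.
rewrite sqrtrM ?sqr_ge0// sqrtr_sqr ger0_norm; last lra.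
set s := Num.sqrt _; have s2 : s ^+ 2 = x ^+ 2 - 1 by rewrite sqr_sqrtr.
have -> : 2 * x ^+ 2 - 1 + 2 * x * s = (x + s) ^+ 2.
  by rewrite sqrrD s2; ring.
rewrite lnXn ?mulr_natl//; apply: ltr_pwDl; first lra.
exact: sqrtr_ge0.
Qed.

Lemma ord2P (i : 'I_2) : i = 0 \/ i = 1.
Proof. by case: i => [[|[|//]] ?]; [left|right]; exact/val_inj. Qed.

Lemma ord3P (i : 'I_3) : i = 0 \/ i = 1 \/ i = 2.
Proof.
by case: i => [[|[|[|//]]] ?]; [left|right; left|right; right]; exact/val_inj.
Qed.

(** * The symmetric square of a two by two matrix *)

Section Algebra.
Context {R : realType}.
Implicit Types (M N : 'M[R]_2) (s t : 'cV[R]_3).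

Definition mat2 (a b c d : R) : 'M[R]_2 :=
  \matrix_(i < 2, j < 2) nth 0 (nth [::] [:: [:: a; b]; [:: c; d]] i) j.

Definition col3 (x y z : R) : 'cV[R]_3 := \col_(i < 3) nth 0 [:: x; y; z] i.

(** The column [(X, Y, Z)] stands for the symmetric matrix with rows
    [(X, Y)] and [(Y, Z)]; [sym2 M] is the action [S |-> M S M^T] on these
    columns, the symmetric square of [M]. *)
Definition sym2 M : 'M[R]_3 :=
  let a := M 0 0 in let b := M 0 1 in let c := M 1 0 in let d := M 1 1 in
  \matrix_(i < 3, j < 3) nth 0 (nth [::]
    [:: [:: a ^+ 2; 2 * a * b; b ^+ 2];
        [:: a * c; a * d + b * c; b * d];
        [:: c ^+ 2; 2 * c * d; d ^+ 2]] i) j.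

(** The polarisation of [- det] on symmetric matrices. *)
Definition qform s t : R :=
  s 1 0 * t 1 0 - (s 0 0 * t 2 0 + s 2 0 * t 0 0) / 2.

(** The linear form on symmetric matrices whose value at [w w^T] is
    [det (M w, w)], up to sign; its zero set is the axis of [M]. *)
Definition axis_form M s : R :=
  M 1 0 * s 0 0 + (M 1 1 - M 0 0) * s 1 0 - M 0 1 * s 2 0.

Lemma mul2E M N i j : (M *m N) i j = M i 0 * N 0 j + M i 1 * N 1 j.
Proof.
rewrite mxE !big_ord_recl big_ord0 addr0.
by congr (_ + M i _ * N _ j); apply/val_inj.
Qed.

Lemma eq2 M N : M 0 0 = N 0 0 -> M 0 1 = N 0 1 -> M 1 0 = N 1 0 ->
  M 1 1 = N 1 1 -> M = N.
Proof.
by move=> e00 e01 e10 e11; apply/matrixP => i j; case: (ord2P i) => ->;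
  case: (ord2P j) => ->.
Qed.

Lemma mul3E (A : 'M[R]_3) s i :
  (A *m s) i 0 = A i 0 * s 0 0 + A i 1 * s 1 0 + A i 2 * s 2 0.
Proof.
rewrite mxE !big_ord_recl big_ord0 addr0 addrA.
by congr (_ + A i _ * s _ 0 + A i _ * s _ 0); apply/val_inj.
Qed.

Lemma eq3 s t : s 0 0 = t 0 0 -> s 1 0 = t 1 0 -> s 2 0 = t 2 0 -> s = t.
Proof.
by move=> e0 e1 e2; apply/matrixP => i j; rewrite (ord1 j);
  case: (ord3P i) => [|[]] ->.
Qed.

Lemma mx_ext n (A B : 'M[R]_n) :
  (forall x : 'cV_n, A *m x = B *m x) -> A = B.
Proof.
by move=> AB; apply/matrixP => i j; have := AB (delta_mx j 0);
  rewrite -!colE => /matrixP/(_ i 0); rewrite !mxE.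
Qed.

Lemma det2E M : \det M = M 0 0 * M 1 1 - M 0 1 * M 1 0.
Proof.
rewrite (expand_det_row _ 0) !big_ord_recl big_ord0 /cofactor !det_mx11 !mxE /=.
rewrite addr0 expr0 mul1r /bump /= expr1 mulN1r mulrN.
by congr (_ * M _ _ - M _ _ * M _ _); exact/val_inj.
Qed.

Lemma tr2E M : \tr M = M 0 0 + M 1 1.
Proof.
by rewrite /mxtrace !big_ord_recl big_ord0 addr0; congr (_ + M _ _);
  exact/val_inj.
Qed.

Lemma sym2E M s : sym2 M *m s = col3
  (M 0 0 ^+ 2 * s 0 0 + 2 * M 0 0 * M 0 1 * s 1 0 + M 0 1 ^+ 2 * s 2 0)
  (M 0 0 * M 1 0 * s 0 0 + (M 0 0 * M 1 1 + M 0 1 * M 1 0) * s 1 0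
     + M 0 1 * M 1 1 * s 2 0)
  (M 1 0 ^+ 2 * s 0 0 + 2 * M 1 0 * M 1 1 * s 1 0 + M 1 1 ^+ 2 * s 2 0).
Proof. by apply: eq3; rewrite mul3E !mxE. Qed.

Lemma sym2M M N : sym2 (M *m N) = sym2 M *m sym2 N.
Proof.
apply: mx_ext => s; rewrite -mulmxA !sym2E !mul2E.
by apply: eq3; rewrite !mxE /=; ring.
Qed.

Lemma sym2_1 : sym2 1%:M = 1%:M.
Proof.
apply: mx_ext => s; rewrite sym2E mul1mx.
by apply: eq3; rewrite !mxE /=; ring.
Qed.

Lemma sym2N M : sym2 (- M) = sym2 M.
Proof.
by apply: mx_ext => s; rewrite !sym2E !mxE; apply: eq3; rewrite !mxE /=; ring.
Qed.

Lemma det_sym2 M : \det (sym2 M) = (\det M) ^+ 3.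
Proof.
rewrite det2E (expand_det_row _ 0) !big_ord_recl big_ord0.
rewrite /cofactor !det2E !mxE /= /bump /=.
ring.
Qed.

Lemma tr_sym2 M : \tr (sym2 M) = (\tr M) ^+ 2 - \det M.
Proof.
by rewrite det2E tr2E /mxtrace !big_ord_recl big_ord0 !mxE /= /bump /=; ring.
Qed.

Lemma sym2_eq1 M : sym2 M = 1%:M -> M 0 1 = 0 /\ M 1 0 = 0.
Proof.
move=> /matrixP e; have := e 0 2; have := e 2 0; rewrite !mxE /=.
by move=> /eqP c /eqP b; split; apply/eqP; rewrite -sqrf_eq0.
Qed.

(** With [<_, _>] for [qform],
    [- 2 <S, M S M^T> = det S * (tr M ^ 2 - 2) + (axis_form M S) ^ 2] when
    [det M = 1]: the displacement of a point is least on the axis, where its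
    hyperbolic cosine is [tr M ^ 2 / 2 - 1]; an isotropic vector is mapped
    to a multiple of itself exactly when it lies on the axis. *)
Lemma displacement M s : \det M = 1 ->
  - (2 * qform s (sym2 M *m s)) =
  - qform s s * ((\tr M) ^+ 2 - 2) + axis_form M s ^+ 2.
Proof.
rewrite det2E tr2E sym2E /qform /axis_form !mxE /= => d1.
set a := M 0 0 in d1 *; set b := M 0 1 in d1 *.
set c := M 1 0 in d1 *; set d := M 1 1 in d1 *.
have e : a * d = 1 + b * c by rewrite -d1; ring.
have -> : (a + d) ^+ 2 - 2 = a^+2 + d ^+ 2 + 2 * (b * c).
  by rewrite sqrrD e; ring.
have : (a * d - b * c - 1) * (s 1 0 * s 1 0) = 0 by rewrite d1 subrr mul0r.
have : (a * d - b * c - 1) * (s 0 0 * s 2 0) = 0 by rewrite d1 subrr mul0r.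
set X := s 0 0; set Y := s 1 0; set Z := s 2 0.
lra.
Qed.

Lemma qform_sym2 M s t : 
  qform (sym2 M *m s) (sym2 M *m t) = (\det M) ^+ 2 * qform s t.
Proof. by rewrite det2E /qform !sym2E !mxE /=; field. Qed.

End Algebra.

Lemma isotropic_orthogonal (R : realType) (s t : 'cV[R]_3) :
  qform s s = 0 -> qform t t = 0 -> qform s t = 0 -> t != 0 ->
  exists k, s = k *: t.
Proof.
rewrite /qform => ss tt st tn0.
have [t0|t0] := eqVneq (t 0 0) 0.
- have t1 : t 1 0 = 0 by apply/eqP; rewrite -sqrf_eq0; apply/eqP; nra.
  have t2 : t 2 0 != 0.
    by apply: contra_neq tn0 => t2; apply: eq3; rewrite mxE.
  have s0 : s 0 0 = 0 by apply: (mulIf t2); rewrite mul0r; nra.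
  have s1 : s 1 0 = 0 by apply/eqP; rewrite -sqrf_eq0; apply/eqP; nra.
  exists (s 2 0 / t 2 0); apply: eq3; rewrite mxE ?t0 ?t1 ?s0 ?s1 ?mulr0//.
  by rewrite divfK.
- have s1 : s 1 0 = s 0 0 / t 0 0 * t 1 0.
    apply: (mulIf t0); rewrite mulrAC divfK//; apply/eqP.
    rewrite -subr_eq0 -sqrf_eq0; apply/eqP.
    have -> : (s 1 0 * t 0 0 - s 0 0 * t 1 0) ^+ 2 =
      t 0 0 ^+ 2 * (s 1 0 * s 1 0 - (s 0 0 * s 2 0 + s 2 0 * s 0 0) / 2) +
      s 0 0 ^+ 2 * (t 1 0 * t 1 0 - (t 0 0 * t 2 0 + t 2 0 * t 0 0) / 2) -
      2 * (s 0 0 * t 0 0) *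
        (s 1 0 * t 1 0 - (s 0 0 * t 2 0 + s 2 0 * t 0 0) / 2) by field.
    by rewrite ss tt st !mulr0 subr0 addr0.
  exists (s 0 0 / t 0 0); apply: eq3; rewrite mxE ?divfK//.
  apply: (mulIf t0); rewrite mulrAC divfK//.
  have e : t 1 0 * t 1 0 = t 0 0 * t 2 0 by lra.
  have -> : s 2 0 * t 0 0 = 2 * (s 1 0 * t 1 0) - s 0 0 * t 2 0 by lra.
  by rewrite s1 -mulrA e; field.
Qed.

Lemma lorentzZZ (R : realType) (a b : R) (x y : 'cV[R]_3) :
  lorentz (a *: x) (b *: y) = a * b * lorentz x y.
Proof. by rewrite /lorentz !mxE; ring. Qed.

(** * Isometries read in a frame *)

(** A frame [P] identifies symmetric matrices with vectors of the Lorentz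
    space. The image of a definite or isotropic matrix lies in the future cone
    up to a sign, and lengths and rays are insensitive to this sign. *)
Section Frame.
Context {R : realType} (P : 'M[R]_3).
Hypothesis P_unit : P \in unitmx.
Hypothesis P_iso : forall s t, lorentz (P *m s) (P *m t) = qform s t.
Implicit Types (M N : 'M[R]_2) (s t : 'cV[R]_3).

(** Locked, so that unification does not see a product in it. *)
Definition isometry M : 'M[R]_3 := locked (P *m sym2 M *m invmx P).

Let isometry_def M : isometry M = P *m sym2 M *m invmx P.
Proof. by rewrite /isometry -lock. Qed.

Lemma isometryE M s : isometry M *m (P *m s) = P *m (sym2 M *m s).
Proof. by rewrite isometry_def -!mulmxA (mulmxA (invmx P)) mulVmx// mul1mx. Qed.

Lemma isometryM M N : isometry (M *m N) = isometry M *m isometry N.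
Proof.
by rewrite !isometry_def sym2M -!mulmxA (mulmxA (invmx P)) mulVmx// mul1mx.
Qed.

Lemma isometry1 : isometry 1%:M = 1%:M.
Proof. by rewrite !isometry_def sym2_1 mulmx1 mulmxV. Qed.

Lemma isometryN M : isometry (- M) = isometry M.
Proof. by rewrite !isometry_def sym2N. Qed.

Lemma frame_inj : injective (mulmx P : 'cV_3 -> 'cV_3).
Proof.
by move=> s t /(congr1 (mulmx (invmx P))); rewrite !mulmxA mulVmx// !mul1mx.
Qed.

Lemma isometry_inj M N : isometry M = isometry N -> sym2 M = sym2 N.
Proof.
move=> MN; apply: mx_ext => s; apply: frame_inj.
by rewrite -!isometryE MN.
Qed.

Lemma eq_isometry M N : sym2 M = sym2 N -> isometry M = isometry N.
Proof. by rewrite !isometry_def => ->. Qed.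

Lemma det_isometry M : \det (isometry M) = (\det M) ^+ 3.
Proof.
rewrite isometry_def !det_mulmx mulrAC -det_mulmx mulmxV// det1 mul1r.
exact: det_sym2.
Qed.

Lemma frame_coord x : exists s, x = P *m s.
Proof. by exists (invmx P *m x); rewrite mulmxA mulmxV// mul1mx. Qed.

Lemma isotropic_ideal s : qform s s = 0 -> s != 0 ->
  exists2 e, e != 0 & ideal (P *m (e *: s)).
Proof.
move=> ss sn0; have := ss; rewrite -P_iso; set x := P *m s => xx.
have x0 : x 0 0 != 0.
  apply: contra_neq sn0 => x0; apply: frame_inj; rewrite mulmx0 -/x.
  have := xx; rewrite /lorentz x0 mul0r subr0 => /eqP.
  rewrite paddr_eq0 ?sqr_ge0 -?expr2 ?sqr_ge0// !sqrf_eq0 => /andP[/eqP x1 /eqP x2].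
  by apply: eq3; rewrite [RHS]mxE.
have scal e : lorentz (e *: x) (e *: x) = 0.
  by rewrite lorentzZZ xx mulr0.
have [xp|xn|/eqP] := ltgtP 0 (x 0 0); last by rewrite eq_sym (negbTE x0).
- by exists 1; rewrite ?oner_neq0//; rewrite -scalemxAr; split; rewrite // mxE mul1r.
- exists (-1); rewrite ?oppr_eq0 ?oner_neq0//; rewrite -scalemxAr; split; rewrite // mxE.
  by rewrite mulN1r oppr_gt0.
Qed.

Lemma timelike_plane s : qform s s = -1 ->
  exists2 e, e * e = 1 & hyperbolic_plane (P *m (e *: s)).
Proof.
rewrite -P_iso; set x := P *m s => xx.
have scal e : e * e = 1 -> lorentz (e *: x) (e *: x) = -1.
  by move=> ee; rewrite lorentzZZ ee mul1r.
have [xp|xn|x0] := ltgtP 0 (x 0 0).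
- exists 1; rewrite ?mulr1// -scalemxAr; split; first by apply: scal; rewrite mulr1.
  by rewrite mxE mul1r.
- exists (-1); first by rewrite mulrNN mulr1.
  rewrite -scalemxAr; split; first by apply: scal; rewrite mulrNN mulr1.
  by rewrite mxE mulN1r oppr_gt0.
- move: xx; rewrite /lorentz -x0; nra.
Qed.

Lemma ideal_isotropic s : ideal (P *m s) -> qform s s = 0 /\ s != 0.
Proof.
move=> [ss s0]; split; first by rewrite -P_iso.
by apply: contraTneq s0 => ->; rewrite mulmx0 mxE ltxx.
Qed.

Lemma fixes_idealE M s : \det M = 1 -> ideal (P *m s) ->
  fixes_ideal (isometry M) (P *m s) <-> axis_form M s = 0.
Proof.
move=> d1 /ideal_isotropic[ss sn0].
have := displacement s d1; rewrite ss oppr0 mul0r add0r => disp.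
rewrite /fixes_ideal isometryE; split.
- move=> [k]; rewrite scalemxAr => /frame_inj sk.
  have : axis_form M s ^+ 2 = 0.
    have -> : axis_form M s ^+ 2 = - (2 * (k * qform s s)).
      by rewrite -disp sk /qform !mxE; field.
    by rewrite ss !mulr0 oppr0.
  by move/eqP; rewrite sqrf_eq0 => /eqP.
- move=> l0; have [] := @isotropic_orthogonal _ (sym2 M *m s) s _ ss _ sn0.
  + by rewrite qform_sym2 ss mulr0.
  + move: disp; rewrite l0 expr0n/= => e.
    by rewrite (_ : qform _ _ = qform s (sym2 M *m s)); rewrite /qform in e *; lra.
  + by move=> k ->; exists k; rewrite scalemxAr.
Qed.

(** On the cone, [axis_form M] is a binary quadratic form of discriminant
    [tr M ^ 2 - 4]. If this is not positive, the form has at most one ray of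
    zeros or vanishes identically; in the latter case every ray is fixed. *)
Lemma hyperbolic_trace M : \det M = 1 -> hyperbolic (isometry M) ->
  4 < (\tr M) ^+ 2.
Proof.
move=> d1 [v [w [vi wi vw fixP]]].
have [s1 ve] := frame_coord v; have [s2 we] := frame_coord w; subst v w.
have [n1 z1] := ideal_isotropic vi; have [n2 z2] := ideal_isotropic wi.
have l1 : axis_form M s1 = 0.
  by apply/fixes_idealE => //; apply/fixP => //; left; exists 1; rewrite scale1r.
have l2 : axis_form M s2 = 0.
  by apply/fixes_idealE => //; apply/fixP => //; right; exists 1; rewrite scale1r.
have indep t : (exists k, s1 = k *: t) -> (exists k, s2 = k *: t) -> False.
  move=> [k1 e1] [k2 e2]; apply: vw; exists (k1 / k2).
  have k2n0 : k2 != 0 by apply: contra_neq z2; rewrite e2 => ->; rewrite scale0r.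
  by rewrite e1 e2 scalemxAr scalerA divfK.
rewrite ltNge; apply/negP; rewrite tr2E => tr_le.
move: d1 fixP l1 l2 (n1) (n2); rewrite det2E.
set a := M 0 0 in tr_le *; set b := M 0 1; set c := M 1 0; set d := M 1 1 in tr_le *.
move=> d1 fixP; rewrite /axis_form /qform -/a -/b -/c -/d => l1 l2 m1 m2.
have disc : (d - a) ^+ 2 + 4 * (b * c) <= 0 by lra.
(* completing the square in c x ^ 2 + (d - a) x y - b y ^ 2 *)
have [c0|cn0] := eqVneq c 0; last first.
  have ray (x y z : R) : c * x + (d - a) * y - b * z = 0 ->
      y * y - (x * z + z * x) / 2 = 0 ->
      x = (a - d) / (2 * c) * y /\ y = (a - d) / (2 * c) * z.
    move=> l m.
    have sq u u' : (2 * c * u + (d - a) * u') ^+ 2 =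
       ((d - a) ^+ 2 + 4 * (b * c)) * u' ^+ 2 -> u = (a - d) / (2 * c) * u'.
      move=> e; have : (2 * c * u + (d - a) * u') ^+ 2 <= 0.
        by rewrite e mulr_le0_ge0// sqr_ge0.
      rewrite -[_ <= _]andbT -(sqr_ge0 (2 * c * u + (d - a) * u')) -eq_le sqrf_eq0.
      move=> /eqP e0; apply: (mulfI cn0).
      have -> : c * ((a - d) / (2 * c) * u') = (a - d) * u' / 2 by field.
      lra.
    have e : y * y = x * z by lra.
    split; apply: sq; apply/eqP; rewrite -subr_eq0; apply/eqP.
      transitivity (4 * c * x * (c * x + (d - a) * y - b * z) +
                    4 * b * c * (x * z - y * y)); first by ring.
      by rewrite l e subrr !mulr0 addr0.
    transitivity (4 * c * z * (c * x + (d - a) * y - b * z) +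
                  4 * c ^+ 2 * (y * y - x * z)); first by ring.
    by rewrite l e subrr !mulr0 addr0.
  set r := (a - d) / (2 * c) in ray.
  have [x1 y1] := ray _ _ _ l1 m1; have [x2 y2] := ray _ _ _ l2 m2.
  apply: (indep (col3 (r * r) r 1)).
    exists (s1 2 0); apply: eq3; rewrite !mxE /= ?mulr1//.
    - by rewrite x1 y1; ring.
    - by rewrite y1; ring.
  exists (s2 2 0); apply: eq3; rewrite !mxE /= ?mulr1//.
  - by rewrite x2 y2; ring.
  - by rewrite y2; ring.
have ad : d - a = 0.
  by apply/eqP; rewrite -sqrf_eq0 eq_le sqr_ge0 andbT; move: disc; rewrite c0; lra.
have [b0|bn0] := eqVneq b 0; last first.
  have ray (x y z : R) : c * x + (d - a) * y - b * z = 0 ->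
      y * y - (x * z + z * x) / 2 = 0 -> y = 0 /\ z = 0.
    rewrite c0 ad !mul0r !add0r => /eqP; rewrite oppr_eq0 mulf_eq0 (negbTE bn0)/=.
    move=> /eqP-> m; split=> //; apply/eqP; rewrite -sqrf_eq0; apply/eqP; lra.
  have [y1 u1] := ray _ _ _ l1 m1; have [y2 u2] := ray _ _ _ l2 m2.
  apply: (indep (col3 1 0 0)).
    by exists (s1 0 0); apply: eq3; rewrite !mxE /= ?mulr0 ?mulr1.
  by exists (s2 0 0); apply: eq3; rewrite !mxE /= ?mulr0 ?mulr1.
(* M is a scalar matrix: three rays cannot all lie among the two fixed ones *)
have on s : qform s s = 0 -> s != 0 ->
    (exists k, s = k *: s1) \/ (exists k, s = k *: s2).
  move=> ss sn0; have [e en0 si] := isotropic_ideal ss sn0.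
  have : fixes_ideal (isometry M) (P *m (e *: s)).
    apply/fixes_idealE => //; first by rewrite det2E.
    by rewrite /axis_form -/a -/b -/c -/d c0 ad b0 !mul0r addr0 subr0.
  move/fixP => /(_ si)[] [k]; rewrite scalemxAr => /frame_inj ek; [left|right];
    exists (e^-1 * k); by rewrite -scalerA -ek scalerA mulVf// scale1r.
have cross (z s t : 'cV[R]_3) : (exists k, s = k *: z) -> (exists k, t = k *: z) ->
    s 0 0 * t 2 0 = s 2 0 * t 0 0.
  by move=> [k ->] [l ->]; rewrite !mxE; ring.
have ray (x y z : R) i : y * y = x * z -> col3 x y z i 0 = 1 ->
    (exists k, col3 x y z = k *: s1) \/ (exists k, col3 x y z = k *: s2).
  move=> yy si; apply: on; first by rewrite /qform !mxE /=; lra.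
  apply/eqP => s0; move: si; rewrite s0 mxE => /eqP.
  by rewrite eq_sym oner_eq0.
have no12 (z : 'cV[R]_3) : (exists k, col3 1 0 0 = k *: z) ->
    (exists k, col3 0 0 1 = k *: z) -> False.
  by move=> e f; have := cross _ _ _ e f; rewrite !mxE/=; lra.
have no13 (z : 'cV[R]_3) : (exists k, col3 1 0 0 = k *: z) ->
    (exists k, col3 1 1 1 = k *: z) -> False.
  by move=> e f; have := cross _ _ _ e f; rewrite !mxE/=; lra.
have no23 (z : 'cV[R]_3) : (exists k, col3 0 0 1 = k *: z) ->
    (exists k, col3 1 1 1 = k *: z) -> False.
  by move=> e f; have := cross _ _ _ e f; rewrite !mxE/=; lra.
by have [||r1|r1] := ray 1 0 0 0; rewrite ?mulr0 ?mxE //;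
  have [||r2|r2] := ray 0 0 1 2; rewrite ?mul0r ?mxE //;
  have [||r3|r3] := ray 1 1 1 0; rewrite ?mxE //; eauto.
Qed.
(** Here the axis is [c X = b Z], which meets the cone in the two rays
    [(b, + sqrt (b c), c)] and [(b, - sqrt (b c), c)]. *)
Lemma hyperbolic_balanced M : \det M = 1 -> M 0 0 = M 1 1 ->
  0 < M 0 1 -> 0 < M 1 0 -> hyperbolic (isometry M).
Proof.
move=> d1 ad; set b := M 0 1; set c := M 1 0 => b0 c0.
set r := Num.sqrt (b * c); have r2 : r * r = b * c.
  by rewrite -expr2 sqr_sqrtr// mulr_ge0// ltW.
have r0 : 0 < r by rewrite sqrtr_gt0 mulr_gt0.
have onaxis s : axis_form M s = c * s 0 0 - b * s 2 0.
  by rewrite /axis_form ad subrr mul0r addr0.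
pose s1 := col3 b r c; pose s2 := col3 b (- r) c.
have nz (y : R) : col3 b y c != 0.
  by apply/eqP => /matrixP/(_ 0 0); rewrite !mxE /= => b0'; move: b0; rewrite b0' ltxx.
have [|e1 e1n i1] := @isotropic_ideal s1 _ (nz _).
  by rewrite /qform !mxE /= r2; field.
have [|e2 e2n i2] := @isotropic_ideal s2 _ (nz _).
  by rewrite /qform !mxE /= mulrNN r2; field.
exists (P *m (e1 *: s1)), (P *m (e2 *: s2)); split=> //.
  move=> [k]; rewrite scalemxAr => /frame_inj/matrixP e.
  have := e 0 0; have := e 1 0; rewrite !mxE /= => f g.
  have eb : e1 = k * e2 by apply: (mulIf (lt0r_neq0 b0)); lra.
  have : e1 * r = 0 by nra.
  by move/eqP; rewrite mulf_eq0 (negbTE e1n) gt_eqF.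
move=> u ui; have [s us] := frame_coord u; subst u.
have [ss sn0] := ideal_isotropic ui.
rewrite fixes_idealE// onaxis; split=> [l|].
  have e2' : s 2 0 = s 0 0 / b * c.
    by apply: (mulIf (lt0r_neq0 b0)); rewrite mulrAC divfK ?lt0r_neq0//; lra.
  have : (s 1 0 - s 0 0 / b * r) * (s 1 0 + s 0 0 / b * r) = 0.
    have -> : (s 1 0 - s 0 0 / b * r) * (s 1 0 + s 0 0 / b * r) =
       s 1 0 * s 1 0 - (s 0 0 / b) ^+ 2 * (r * r) by ring.
    move: ss; rewrite /qform e2' r2 => <-; field.
    by rewrite lt0r_neq0.
  move/eqP; rewrite mulf_eq0 => /orP[|] /eqP e; [left|right].
    exists (s 0 0 / b / e1); rewrite scalemxAr scalerA divfK//; congr (P *m _).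
    by apply: eq3; rewrite !mxE /= ?divfK ?lt0r_neq0//; lra.
  exists (s 0 0 / b / e2); rewrite scalemxAr scalerA divfK//; congr (P *m _).
  by apply: eq3; rewrite !mxE /= ?divfK ?lt0r_neq0//; lra.
by case=> [] [k]; rewrite scalemxAr => /frame_inj ->; rewrite !mxE /=; ring.
Qed.

(** A displacement formula: the last term vanishes on the axis only. *)
Lemma hdist_isometry M s : \det M = 1 -> qform s s = -1 ->
  hdist (P *m s) (isometry M *m (P *m s)) =
  arccosh ((\tr M) ^+ 2 / 2 - 1 + axis_form M s ^+ 2 / 2).
Proof.
move=> d1 ss; rewrite /hdist isometryE P_iso; congr arccosh.
have := displacement s d1; rewrite ss; lra.
Qed.

Lemma hlength_ge M : \det M = 1 -> 4 <= (\tr M) ^+ 2 ->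
  arccosh ((\tr M) ^+ 2 / 2 - 1) <= hlength (isometry M).
Proof.
move=> d1 tr4; apply: lb_le_inf.
  have [|e _ Hx] := @timelike_plane (col3 1 0 1).
    by rewrite /qform !mxE /=; field.
  by exists (hdist (P *m (e *: col3 1 0 1))
    (isometry M *m (P *m (e *: col3 1 0 1)))); eexists; [exact: Hx|].
move=> _ [x Hx <-]; have [s xs] := frame_coord x; subst x.
case: Hx; rewrite P_iso => ss _; rewrite hdist_isometry//.
have := sqr_ge0 (axis_form M s) => ax.
apply: ler_arccosh; lra.
Qed.

(** The axis [c X = b Z] passes through the point
    [(sqrt (b / c), 0, sqrt (c / b))]. *)
Lemma hlength_balanced M : \det M = 1 -> 4 <= (\tr M) ^+ 2 ->
  M 0 0 = M 1 1 -> 0 < M 0 1 -> 0 < M 1 0 ->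
  hlength (isometry M) = arccosh ((\tr M) ^+ 2 / 2 - 1).
Proof.
move=> d1 tr4 ad; set b := M 0 1; set c := M 1 0 => b0 c0.
apply/le_anti; rewrite hlength_ge// andbT.
have q0 : 0 < b / c by rewrite divr_gt0.
pose r := Num.sqrt (b / c).
have r0 : 0 < r by rewrite sqrtr_gt0.
have rr : r * r = b / c by rewrite -expr2 sqr_sqrtr// ltW.
pose s := col3 r 0 r^-1.
have ss : qform s s = -1 by rewrite /qform !mxE /=; field; rewrite gt_eqF.
have [e ee Hx] := timelike_plane ss.
have l0 : axis_form M (e *: s) = 0.
  rewrite /axis_form ad subrr mul0r addr0 -/b -/c !mxE /=.
  have -> : r^-1 = r / (b / c) by rewrite -rr; field; rewrite gt_eqF.
  by field; rewrite !gt_eqF.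
have -> : arccosh ((\tr M) ^+ 2 / 2 - 1) =
    hdist (P *m (e *: s)) (isometry M *m (P *m (e *: s))).
  rewrite hdist_isometry//; last by case: Hx; rewrite P_iso.
  by rewrite l0 expr0n mul0r addr0.
apply: ge_inf; last by exists (P *m (e *: s)).
exists (arccosh 1) => _ [x Hy <-]; have [t xt] := frame_coord x; subst x.
case: Hy; rewrite P_iso => tt _; rewrite hdist_isometry//.
have := sqr_ge0 (axis_form M t) => ax.
apply: ler_arccosh; lra.
Qed.

End Frame.

(** * Words in the triangle group *)

Section Words.
Context {R : realType} (p : nat) (theta : R).
Hypotheses (p_ge6 : (6 <= p)%N) (p_theta : p%:R * theta = pi).
Implicit Types (k a b : int) (l h m : seq int).

(** The [k]-th Chebyshev value: the ratio of the chords of a regular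
    [p]-gon that span [k] sides and one side. *)
Definition chord k : R := sin (k%:~R * theta) / sin theta.

(** Up to sign, [U V ^ k] in [SL_2], where [U] is the rotation of order two
    about [i] and [V], with rows [(0, -1)] and [(1, 2 cos theta)], a rotation
    of order [p] modulo signs. A word in [U] and [V] is, up to sign, a product of such
    syllables, because [U U = - 1]; for [0 < k < p] a syllable has nonnegative
    entries. *)
Definition syl k : 'M[R]_2 :=
  mat2 (chord k) (chord (k + 1)) (chord (k - 1)) (chord k).

Definition word l : 'M[R]_2 := foldr (fun k M => syl k *m M) 1%:M l.

Definition wsum l : int := \sum_(k <- l) k.

Notation E l := (sym2 (word l)).

Let p_gt0 : 0 < p%:R :> R. Proof. by rewrite ltr0n; lia. Qed.

Lemma theta_gt0 : 0 < theta.
Proof. by rewrite -(pmulr_rgt0 _ p_gt0) p_theta pi_gt0. Qed.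

Lemma theta_lt : 5 * theta < pi.
Proof.
rewrite -p_theta ltr_pM2r ?theta_gt0//.
by rewrite ltr_nat; lia.
Qed.

Let sin_theta : 0 < sin theta.
Proof.
by apply: sin_gt0_pi; have := theta_lt; have := theta_gt0; lra.
Qed.

Let sin_neq0 : sin theta != 0. Proof. exact: lt0r_neq0. Qed.

Lemma chord0 : chord 0 = 0.
Proof. by rewrite /chord mul0r sin0 mul0r. Qed.

Lemma chord1 : chord 1 = 1.
Proof. by rewrite /chord mul1r divff. Qed.

Lemma chordN k : chord (- k) = - chord k.
Proof. by rewrite /chord mulrNz mulNr sinN mulNr. Qed.

Lemma chordDp k : chord (k + p%:Z) = - chord k.
Proof. by rewrite /chord intrD mulrDl -pmulrn p_theta sinDpi mulNr. Qed.

Lemma chord_add a b :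
  chord (a + 1) * chord b - chord a * chord (b - 1) = chord (a + b).
Proof.
rewrite /chord !intrD !mulrDl mul1r mulrNz mulN1r.
by rewrite sinB !sinD; field.
Qed.

Lemma chord_2 : chord 2 = 2 * cos theta.
Proof.
rewrite /chord (_ : 2%:~R * theta = theta + theta); last first.
  by rewrite -mulr2n mulr_natl.
by rewrite sinD; field.
Qed.

Lemma chord_3 : chord 3 = 4 * cos theta ^+ 2 - 1.
Proof.
have := chord_add 1 2; rewrite (_ : 2 - 1 = 1 :> int) // (_ : 1 + 2 = 3 :> int) //.
by rewrite (_ : 1 + 1 = 2 :> int) // chord1 chord_2 => <-; ring.
Qed.

Lemma chordDB b : chord (b - 1) - chord (b + 1) = - (2 * cos (b%:~R * theta)).
Proof.
by rewrite /chord !intrD !(mulrDl b%:~R) mulrNz mulN1r (mul1r theta) sinB sinD; field.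
Qed.

Lemma ler_chord a b : 0 <= a -> a <= b -> a + b <= p%:Z -> chord a <= chord b.
Proof.
move=> a0 ab abp; rewrite ler_pM2r ?invr_gt0//.
have t0 := theta_gt0; apply: sin_ler.
- by rewrite mulr_ge0 ?ler0z// ltW.
- by rewrite ler_pM2r// ler_int.
- by rewrite -mulrDl -intrD -[leRHS]p_theta ler_pM2r// pmulrn ler_int.
Qed.

Lemma ltr_chord a b : 0 <= a -> a < b -> a + b < p%:Z -> chord a < chord b.
Proof.
move=> a0 ab abp; rewrite ltr_pM2r ?invr_gt0//.
have t0 := theta_gt0; apply: sin_ltr.
- by rewrite mulr_ge0 ?ler0z// ltW.
- by rewrite ltr_pM2r// ltr_int.
- by rewrite -mulrDl -intrD -[ltRHS]p_theta ltr_pM2r// pmulrn ltr_int.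
Qed.

(** The reflection [k |-> p - k] preserves chords, so [chord j <= chord k]
    as soon as [k] is at distance at least [j] from both [0] and [p]. *)
Lemma chord_mono (j k : int) :
  0 <= j -> j <= k -> k <= p%:Z - j -> chord j <= chord k.
Proof. by move=> j0 jk kp; apply: ler_chord => //; lia. Qed.

Lemma syl0 : syl 0 = mat2 0 1 (-1) 0.
Proof. by rewrite /syl chord0 add0r sub0r chordN chord1. Qed.

Lemma det_syl k : \det (syl k) = 1.
Proof.
rewrite det2E !mxE /= -{1}[chord k]opprK -chordN mulNr -opprD.
have := chord_add k (1 - k).
rewrite (_ : k + (1 - k) = 1); last by lia.
rewrite (_ : 1 - k - 1 = - k); last by lia.
rewrite (_ : 1 - k = - (k - 1)); last by lia.
by rewrite !chordN chord1 => <-; ring.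
Qed.

Lemma det_word l : \det (word l) = 1.
Proof. by elim: l => [|k l IH]; rewrite /= ?det1// det_mulmx det_syl IH mul1r. Qed.

Lemma word_cat l m : word (l ++ m) = word l *m word m.
Proof. by elim: l => [|k l IH] /=; rewrite ?mul1mx// IH mulmxA. Qed.

(** This is [U V ^ a U U V ^ b = - U V ^ (a + b)]. *)
Lemma syl_merge a b : syl a *m (syl 0 *m syl b) = - syl (a + b).
Proof.
have e1 := chord_add a b.
have e2 := chord_add a (b + 1).
have e3 := chord_add (a - 1) b.
have e4 := chord_add (a - 1) (b + 1).
move: e2 e3 e4; rewrite addrK subrK addrA (_ : a - 1 + b = a + b - 1); last by lia.
rewrite (_ : a - 1 + (b + 1) = a + b); last by lia.
move=> e2 e3 e4; apply: eq2; rewrite !mul2E syl0 !mxE /=; lra.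
Qed.

Lemma syl_addp k : syl (k + p%:Z) = - syl k.
Proof.
apply: eq2; rewrite !mxE /= ?chordDp//.
- by rewrite (_ : k + p%:Z + 1 = k + 1 + p%:Z) ?chordDp//; lia.
- by rewrite (_ : k + p%:Z - 1 = k - 1 + p%:Z) ?chordDp//; lia.
Qed.

Lemma sym2_syl_modp k : sym2 (syl k) = sym2 (syl (k %% p%:Z)%Z).
Proof.
have per (n : nat) a : sym2 (syl (a + (n * p)%N%:Z)) = sym2 (syl a).
  elim: n a => [|n IH] a; first by rewrite mul0n addr0.
  by rewrite mulSn PoszD addrA IH syl_addp sym2N.
have := divz_eq k p%:Z; set r := (k %% p%:Z)%Z.
case: (k %/ p%:Z)%Z => n k_eq; first by rewrite k_eq addrC -PoszM per.
rewrite -(per n.+1 k); congr (sym2 (syl _)).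
by rewrite k_eq NegzE PoszM; ring.
Qed.

Lemma E_cat l m : E (l ++ m) = E l *m E m.
Proof. by rewrite word_cat sym2M. Qed.

Lemma E_cons k l : E (k :: l) = sym2 (syl k) *m E l.
Proof. by rewrite /= sym2M. Qed.

Lemma E_nil : E [::] = 1%:M. Proof. exact: sym2_1. Qed.

Lemma E_merge a b l : E [:: a, 0, b & l] = E (a + b :: l).
Proof. by rewrite /= !mulmxA -(mulmxA (syl a)) syl_merge mulNmx sym2N. Qed.

Lemma E_00 : E [:: 0; 0] = 1%:M.
Proof.
rewrite -sym2_1 -[RHS]sym2N /= mulmx1.
congr sym2; apply: eq2; rewrite mul2E syl0 !mxE /=; ring.
Qed.

Lemma E_modp k l : E (k :: l) = E ((k %% p%:Z)%Z :: l).
Proof. by rewrite !E_cons sym2_syl_modp. Qed.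

Lemma E_dvdp k l : (p %| k)%Z -> E (k :: l) = E (0 :: l).
Proof. by move=> /dvdz_mod0P k0; rewrite E_modp k0. Qed.

Lemma wsum_cat l m : wsum (l ++ m) = wsum l + wsum m.
Proof. exact: big_cat. Qed.

Lemma wsum_cons k l : wsum (k :: l) = k + wsum l.
Proof. exact: big_cons. Qed.

Lemma wsum_nil : wsum [::] = 0. Proof. exact: big_nil. Qed.

(** From [(U V ^ k)^-1 = V ^ - k U^-1], which is the word
    [U V ^ 0 U V ^ (- k) U V ^ 0] up to sign. *)
Definition winv l : seq int := foldr (fun k m => m ++ [:: 0; - k; 0]) [::] l.

Lemma wsum_winv l : wsum (winv l) = - wsum l.
Proof.
elim: l => [|k l IH]; rewrite /= ?wsum_nil// wsum_cat IH !wsum_cons wsum_nil.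
by rewrite add0r !addr0 opprD addrC.
Qed.

Lemma E_winv l : E (winv l) *m E l = 1%:M.
Proof.
rewrite -E_cat; elim: l => [|k l IH]; first exact: E_nil.
rewrite /= -catA /= -[RHS]IH !E_cat; congr (_ *m _).
rewrite [LHS]E_cons E_merge addNr -E_cons.
by rewrite (_ : [:: 0, 0 & l] = [:: 0; 0] ++ l)// E_cat E_00 mul1mx.
Qed.

Lemma E_winvr l : E l *m E (winv l) = 1%:M.
Proof. exact/mulmx1C/E_winv. Qed.

Lemma E_unit l : E l \in unitmx.
Proof. by have [] := mulmx1_unit (E_winvr l). Qed.

Definition positive l := all (fun k => 0 < k < p%:Z) l.

(** Cyclically reduced words; the middle two cases are [U] and [V ^ b]. *)
Definition reduced l :=
  [\/ l = [::], l = [:: 0], exists2 b, 0 < b < p%:Z & l = [:: 0; b]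
    | l != [::] /\ positive l].

(** Every word is conjugate to a cyclically reduced one: a syllable with
    exponent divisible by [p] is rotated to the front, where its two
    neighbours merge. *)
Lemma word_reduce l : exists l' h,
  [/\ E l *m E h = E h *m E l', (p %| wsum l - wsum l')%Z & reduced l'].
Proof.
have p0 : p%:Z != 0 by lia.
have mod_gt0 a : ~~ (p %| a)%Z -> 0 < (a %% p%:Z)%Z < p%:Z.
  move=> pa; rewrite lt_neqAle modz_ge0// andbT (ltz_mod a p0) andbT eq_sym.
  by apply: contra pa => /eqP/dvdz_mod0P.
have dvd_mod a : (p %| a - (a %% p%:Z)%Z)%Z.
  by rewrite {1}(divz_eq a p%:Z) addrK dvdz_mull.
have [n] := ubnP (size l); elim: n l => // n IH l lsz.
have rot l1 l2 : E (l1 ++ l2) *m E l1 = E l1 *m E (l2 ++ l1).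
  by rewrite -!E_cat catA.
have [/allP nz|] := boolP (all (fun k => ~~ (p %| k)%Z) l).
  exists [seq (k %% p%:Z)%Z | k <- l], [::].
  rewrite E_nil mulmx1 mul1mx; split.
  - by elim: l {lsz nz} => //= k l IHl; rewrite !sym2M IHl sym2_syl_modp.
  - elim: l {lsz nz} => [|k l IHl]; first by rewrite subrr dvdz0.
    by rewrite /= !wsum_cons opprD addrACA rpredD.
  - case: l lsz nz => [|k l] _ nz; first exact: Or41.
    apply: Or44; split=> //; apply/allP => _ /mapP[a al ->].
    exact/mod_gt0/nz.
move=> /allPn[k kl /negPn pk].
have [l1 [l2 lE]] : exists l1 l2, l = l1 ++ k :: l2.
  by case/splitPr: kl => l1 l2; exists l1, l2.
have {}IH m : (size m < n)%N -> (p %| wsum l - wsum m)%Z ->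
    (exists h, E l *m E h = E h *m E m) ->
  exists l' h, [/\ E l *m E h = E h *m E l', (p %| wsum l - wsum l')%Z & reduced l'].
  move=> mn lm [h hm]; have [l' [h' [e d r]]] := IH m mn.
  exists l', (h ++ h'); rewrite E_cat mulmxA hm -mulmxA e mulmxA; split=> //.
  by rewrite -[_ - _](subrKA (wsum m)) rpredD.
pose m := l2 ++ l1.
have lm : E l *m E l1 = E l1 *m E (k :: m) by rewrite lE rot.
have sm : wsum l = k + wsum m.
  by rewrite lE !wsum_cat wsum_cons addrCA [wsum l1 + _]addrC.
have szm : (size m).+1 = size l by rewrite lE !size_cat /= addnS addnC.
case: m lm sm szm => [|a m].
  move=> lm sm _; exists [:: 0], l1; split.
  - by rewrite lm E_dvdp.
  - by rewrite sm wsum_cons wsum_nil !addr0.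
  - exact: Or42.
case/lastP: m => [|m b] lm sm szm.
  have [pa|pa] := boolP (p %| a)%Z.
    exists [::], l1; split; last exact: Or41.
    - by rewrite lm E_dvdp// E_cons (E_dvdp [::] pa) -E_cons E_00 E_nil.
    - by rewrite sm wsum_cons wsum_nil addr0 subr0 rpredD.
  exists [:: 0; (a %% p%:Z)%Z], l1; split.
  - by rewrite lm E_dvdp// !(E_cons 0) (E_modp a).
  - by rewrite sm !wsum_cons wsum_nil !addr0 add0r -addrA rpredD.
  - by apply: Or43; exists (a %% p%:Z)%Z => //; exact: mod_gt0.
apply: (IH (b + a :: m)).
- by move: szm lsz; rewrite /= size_rcons; lia.
- rewrite sm !wsum_cons -cats1 wsum_cat wsum_cons wsum_nil addr0.
  by rewrite (_ : _ - _ = k)//; lia.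
- exists (l1 ++ [:: k, a & m]); rewrite E_cat mulmxA lm -mulmxA.
  have -> : [:: k, a & rcons m b] = [:: k, a & m] ++ [:: b] by rewrite -cats1.
  rewrite rot mulmxA; congr (_ *m _).
  by rewrite [_ ++ _]/= (E_cons b) (E_dvdp _ pk) -E_cons E_merge.
Qed.

Lemma syl_ge1 k i j : 0 < k < p%:Z -> (1%:M : 'M[R]_2) i j <= syl k i j.
Proof.
move=> /andP[k0 kp]; case: (ord2P i) => ->; case: (ord2P j) => ->;
  rewrite !mxE /= ?mulr1n ?mulr0n -?chord1 -?chord0; apply/chord_mono; lia.
Qed.

Lemma ler_mul2 (A A' B B' : 'M[R]_2) :
  (forall i j, 0 <= A i j) -> (forall i j, 0 <= B i j) ->
  (forall i j, A i j <= A' i j) -> (forall i j, B i j <= B' i j) ->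
  forall i j, (A *m B) i j <= (A' *m B') i j.
Proof. by move=> A0 B0 AA BB i j; rewrite !mul2E lerD// ler_pM. Qed.

Let id2_ge0 i j : 0 <= (1%:M : 'M[R]_2) i j.
Proof. by rewrite mxE ler0n. Qed.

Lemma syl_ge0 k i j : 0 < k < p%:Z -> 0 <= syl k i j.
Proof. by move=> kp; exact: le_trans (syl_ge1 _ _ kp). Qed.

Lemma word_ge1 l i j : positive l -> (1%:M : 'M[R]_2) i j <= word l i j.
Proof.
elim: l i j => [//|k l IH] i j /= /andP[kp lp].
rewrite -[1%:M](mulmx1 1%:M); apply: ler_mul2 => // *.
- exact: syl_ge1.
- exact: IH.
Qed.

Lemma word_ge_syl k l i j : positive l -> k \in l -> syl k i j <= word l i j.
Proof.
elim: l i j => [//|a l IH] i j /= /andP[ap lp]; rewrite inE => /predU1P[->|kl].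
  rewrite -[leLHS]/(syl a i j) -{1}[syl a](mulmx1 (syl a)).
  by apply: ler_mul2 => // *; [exact: syl_ge0|exact: word_ge1].
have kp : 0 < k < p%:Z by apply: (allP lp).
rewrite -[syl k](mul1mx (syl k)).
apply: ler_mul2 => // *; [exact: syl_ge0|exact: syl_ge1|exact: IH].
Qed.

(** A reduced word of sum not divisible by [p] has a nonzero off-diagonal
    entry: this is clear for [V ^ b], and a positive word dominates its
    letters. Thus the exponent sum of [V] modulo [p] is a character of the
    group, which separates conjugacy classes. *)
Lemma wsum_ker l : E l = 1%:M -> (p %| wsum l)%Z.
Proof.
move=> l1; have [l' [h [lh d r]]] := word_reduce l.
have {lh l1} l'1 : E l' = 1%:M.
  by rewrite -[E l'](mulKmx (E_unit h)) -lh l1 mul1mx mulVmx// E_unit.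
suff : (p %| wsum l')%Z by rewrite -[wsum l](subrK (wsum l')) => ?; rewrite rpredD.
have [] := sym2_eq1 l'1; case: r => [->|->|[b bp ->]|[l'n l'p]].
- by rewrite wsum_nil dvdz0.
- by rewrite wsum_cons wsum_nil dvdz0.
- move=> _; rewrite /= mulmx1 mul2E syl0 !mxE /= mul0r addr0 mulN1r => /eqP.
  have : 1 <= chord b by rewrite -chord1; apply/chord_mono; lia.
  by rewrite oppr_eq0; case: eqP => // ->; rewrite ler10.
- case: l' l'n l'p {d l'1} => // k l' _ kl.
  have := word_ge_syl 0 1 kl (mem_head _ _).
  have := word_ge_syl 1 0 kl (mem_head _ _).
  rewrite !mxE /= => ge10 ge01 w01 w10; move: ge10 ge01; rewrite w01 w10.
  move: kl => /= /andP[/andP[k0 kp] _].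
  have [kp1|kp1] := leP k (p%:Z - 2).
    have : chord 1 <= chord (k + 1) by apply/chord_mono; lia.
    by rewrite chord1; lra.
  have : chord 1 <= chord (k - 1) by apply/chord_mono; lia.
  by rewrite chord1; lra.
Qed.

Lemma wsum_eq l m : E l = E m -> (p %| wsum l - wsum m)%Z.
Proof.
by move=> lm; rewrite -wsum_winv -wsum_cat wsum_ker// E_cat lm E_winvr.
Qed.

Lemma syl_first : syl 1 = mat2 1 (chord 2) 0 1.
Proof. by rewrite /syl chord1 subrr chord0. Qed.

Lemma syl_last : syl (p%:Z - 1) = mat2 1 0 (chord 2) 1.
Proof.
have e j : chord (p%:Z - j) = chord j by rewrite addrC chordDp chordN opprK.
rewrite /syl subrK -addrA -opprD !e chord1.
by rewrite -[p%:Z]subr0 e chord0.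
Qed.

Lemma chord2_gt1 : 1 < chord 2.
Proof. by rewrite -chord1; apply: ltr_chord; lia. Qed.

Lemma chord2_lt_chord3 : chord 2 < chord 3.
Proof. by apply: ltr_chord; lia. Qed.

Lemma chord2_le2 : chord 2 <= 2.
Proof. by rewrite chord_2 ler_piMr// cos_le1. Qed.

Lemma chord3_sqr : chord 3 = chord 2 ^+ 2 - 1.
Proof. by rewrite chord_3 chord_2; ring. Qed.

Lemma tr_word_rot l m : \tr (word (l ++ m)) = \tr (word (m ++ l)).
Proof. by rewrite !word_cat mxtrace_mulC. Qed.

Lemma positive_split k l : k \in l -> positive l -> exists m,
  [/\ positive m, perm_eq l (k :: m), size l = (size m).+1 &
      \tr (word l) = \tr (syl k *m word m)].
Proof.
case/splitPr => l1 l2 lp; exists (l2 ++ l1); split.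
- by move: lp; rewrite /positive !all_cat /= => /and3P[-> _ ->].
- by rewrite perm_catC.
- by rewrite !size_cat /= addnS addnC.
- by rewrite tr_word_rot.
Qed.

(** Entrywise domination: erasing letters other than [k] and [j] lowers the
    trace. *)
Lemma tr_word_ge k j m : 0 < k < p%:Z -> positive m -> j \in m ->
  2 * (chord k * chord j) + chord (k + 1) * chord (j - 1)
    + chord (k - 1) * chord (j + 1) <= \tr (syl k *m word m).
Proof.
move=> kp mp jm; have jp : 0 < j < p%:Z by apply: (allP mp).
have le i i' : (syl k *m syl j) i i' <= (syl k *m word m) i i'.
  apply: ler_mul2 => // *; [exact: syl_ge0|exact: syl_ge0|exact: word_ge_syl].
have -> : 2 * (chord k * chord j) + chord (k + 1) * chord (j - 1)
    + chord (k - 1) * chord (j + 1) = \tr (syl k *m syl j).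
  by rewrite tr2E !mul2E !mxE /=; ring.
by rewrite !tr2E lerD.
Qed.

Lemma tr_word_ge_mid k j m : 2 <= k <= p%:Z - 2 -> positive m -> j \in m ->
  3 * chord 2 <= \tr (syl k *m word m).
Proof.
move=> kmid mp jm; have jp : 0 < j < p%:Z by apply: (allP mp).
have kp : 0 < k < p%:Z by clear -kmid; lia.
apply: le_trans (tr_word_ge kp mp jm); clear m mp jm.
have [ck ck1 ck2] : [/\ chord 2 <= chord k, chord 1 <= chord (k + 1)
    & chord 1 <= chord (k - 1)] by split; apply/chord_mono; clear -kmid; lia.
have [cj cj1 cj2] : [/\ chord 1 <= chord j, chord 0 <= chord (j + 1)
    & chord 0 <= chord (j - 1)] by split; apply/chord_mono; clear -jp; lia.
have cj3 : chord 2 <= chord (j + 1) \/ chord 2 <= chord (j - 1).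
  have [jle|jgt] := leP j (p%:Z - 3); [left|right];
    by apply/chord_mono; clear -jp jle p_ge6 || clear -jp jgt p_ge6; lia.
have c2 := chord2_gt1; rewrite chord1 in ck1 ck2 cj; rewrite chord0 in cj1 cj2.
have : chord 2 * 1 <= chord k * chord j by apply: ler_pM => //; lra.
suff : chord 2 <= chord (k + 1) * chord (j - 1) + chord (k - 1) * chord (j + 1).
  by lra.
have e1 : chord (j - 1) <= chord (k + 1) * chord (j - 1) by rewrite ler_peMl.
have e2 : chord (j + 1) <= chord (k - 1) * chord (j + 1) by rewrite ler_peMl.
by case: cj3; lra.
Qed.

Lemma tr_word_ge_parabolic m : positive m -> p%:Z - 1 \in m ->
  2 + chord 2 ^+ 2 <= \tr (syl 1 *m word m).
Proof.
move=> mp pm.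
apply: le_trans (tr_word_ge _ mp pm); last by clear -p_ge6; lia.
have [e1 e2] : chord 1 <= chord (p%:Z - 1) /\ chord 2 <= chord (p%:Z - 1 - 1).
  by split; apply/chord_mono; clear -p_ge6; lia.
have c2 := chord2_gt1; rewrite subrr chord0 mul0r addr0 (_ : 1 + 1 = 2)//.
rewrite chord1 mul1r in e1 *.
have : chord 2 * chord 2 <= chord 2 * chord (p%:Z - 1 - 1).
  by rewrite ler_pM2l//; lra.
by rewrite expr2; lra.
Qed.

(** A positive word is a power of one of the two parabolic syllables
    [syl 1] and [syl (p - 1)], or a single syllable, or it contains two
    different parabolic syllables, or a syllable that is not parabolic and
    another one; dropping all its other letters lowers the trace. *)
Lemma positive_trace l : l != [::] -> positive l ->
  [\/ \tr (word l) = 2, l = [:: 2], l = [:: p%:Z - 2]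
    | 2 * chord 3 <= \tr (word l)].
Proof.
move=> ln lp.
have two : 2 * chord 3 <= 3 * chord 2 /\ 2 * chord 3 <= 2 + chord 2 ^+ 2.
  have := chord2_gt1; have := chord2_le2; rewrite chord3_sqr => c2 c1.
  have : chord 2 * chord 2 <= 2 * chord 2 by rewrite ler_pM2r//; lra.
  by rewrite expr2; split; lra.
case: two => bound3 bound2.
have [/hasP[k kl kmid]|/hasPn nomid] :=
    boolP (has (fun k => 2 <= k <= p%:Z - 2) l).
  have [m [mp lm szl ->]] := positive_split kl lp.
  case: m mp lm szl => [|j m] mp lm szl; last first.
    by apply: Or44; apply: le_trans bound3 (tr_word_ge_mid kmid mp (mem_head _ _)).
  have -> : l = [:: k] by apply/perm_small_eq => //; rewrite szl.
  rewrite mulmx1 tr2E !mxE /=.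
  have [->|kn2] := eqVneq k 2; first exact: Or42.
  have [->|knp] := eqVneq k (p%:Z - 2); first exact: Or43.
  have : chord 3 <= chord k by apply/chord_mono; clear -kmid kn2 knp; lia.
  by move=> ?; apply: Or44; lra.
have ends k : k \in l -> k = 1 \/ k = p%:Z - 1.
  move=> kl; have := nomid k kl; have /andP[] : 0 < k < p%:Z by apply: (allP lp).
  by clear; lia.
have [one|none] := boolP (1 \in l); last first.
  apply: Or41; have {}ends k : k \in l -> k = p%:Z - 1.
    by move=> kl; case: (ends k kl) => // k1; rewrite k1 (negbTE none) in kl.
  suff [x ->] : exists x, word l = mat2 1 0 x 1 by rewrite tr2E !mxE.
  elim: l {ln lp nomid none} ends => [|k l IH] ends.
    by exists 0; apply: eq2; rewrite !mxE.
  have [|x wl] := IH; first by move=> a al; apply: ends; rewrite inE al orbT.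
  have -> : k = p%:Z - 1 by apply: ends; exact: mem_head.
  exists (chord 2 + x); rewrite /= wl syl_last.
  by apply: eq2; rewrite mul2E !mxE /=; ring.
have [pone|pnone] := boolP (p%:Z - 1 \in l); last first.
  apply: Or41; have {}ends k : k \in l -> k = 1.
    by move=> kl; case: (ends k kl) => // k1; rewrite k1 (negbTE pnone) in kl.
  suff [x ->] : exists x, word l = mat2 1 x 0 1 by rewrite tr2E !mxE.
  elim: l {ln lp nomid one pnone} ends => [|k l IH] ends.
    by exists 0; apply: eq2; rewrite !mxE.
  have [|x wl] := IH; first by move=> a al; apply: ends; rewrite inE al orbT.
  have -> : k = 1 by apply: ends; exact: mem_head.
  exists (chord 2 + x); rewrite /= wl syl_first.
  by apply: eq2; rewrite mul2E !mxE /=; ring.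
apply: Or44; have [m [mp lm szl ->]] := positive_split one lp.
have pm : p%:Z - 1 \in m.
  by move: pone; rewrite (perm_mem lm) inE => /predU1P[|//]; clear -p_ge6; lia.
exact: le_trans bound2 (tr_word_ge_parabolic mp pm).
Qed.

Lemma tr_E l : \tr (E l) = (\tr (word l)) ^+ 2 - 1.
Proof. by rewrite tr_sym2 det_word. Qed.

(** A word of trace above [2] in absolute value is conjugate to one of the two shortest words or to
    a word of trace at least that of [[:: 3]]. The traces of the other reduced
    words are [2], [0] and [- 2 cos (b theta)], up to sign. *)
Lemma word_trace l : 4 < (\tr (word l)) ^+ 2 -> exists l' h,
  E l *m E h = E h *m E l' /\
  [\/ l' = [:: 2], l' = [:: p%:Z - 2] | 2 * chord 3 <= \tr (word l')].
Proof.
move=> tr4; have [l' [h [lh _ r]]] := word_reduce l; exists l', h; split=> //.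
have trE : \tr (E l) = \tr (E l').
  have -> : E l = E h *m E l' *m invmx (E h) by rewrite -lh mulmxK// E_unit.
  by rewrite mxtrace_mulC mulKmx// E_unit.
have {tr4 trE} : 4 < (\tr (word l')) ^+ 2 by move: trE; rewrite !tr_E; lra.
case: r => [->|->|[b bp ->]|[l'n l'p]].
- by rewrite tr2E !mxE /=; lra.
- by rewrite /= mulmx1 syl0 tr2E !mxE /=; lra.
- rewrite /= mulmx1 tr2E !mul2E syl0 !mxE /=.
  rewrite !(mul0r, add0r, addr0, mul1r, mulN1r) chordDB.
  have := cos_le1 (b%:~R * theta); have := cos_geN1 (b%:~R * theta).
  by move=> ? ?; nra.
- case: (positive_trace l'n l'p) => [->|->|->|?] => tr4.
  + by clear lh; lra.
  + exact: Or31.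
  + exact: Or32.
  + exact: Or33.
Qed.

End Words.
(** * The frame of the triangle *)

Section Triangle.
Context {R : realType}.
Implicit Types x y z : 'cV[R]_3.

Lemma lorentzC x y : lorentz x y = lorentz y x.
Proof. by rewrite /lorentz; ring. Qed.

Lemma lorentz_comb (a b : R) x y z :
  lorentz (a *: x + b *: y) z = a * lorentz x z + b * lorentz y z.
Proof. by rewrite /lorentz !mxE; ring. Qed.

Lemma lorentzZ (a : R) x y : lorentz (a *: x) y = a * lorentz x y.
Proof. by rewrite /lorentz !mxE; ring. Qed.

Lemma lorentz_comb3 (a b c : R) u x y z :
  lorentz (a *: x + (b *: y + c *: z)) u =
  a * lorentz x u + b * lorentz y u + c * lorentz z u.
Proof. by rewrite /lorentz !mxE; ring. Qed.

(** The reversed Cauchy-Schwarz inequality in the future cone. *)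
Lemma lorentz_lt0 x y : lorentz x x = -1 -> lorentz y y <= 0 ->
  0 < x 0 0 -> 0 < y 0 0 -> lorentz x y < 0.
Proof.
rewrite /lorentz => xx yy x0 y0; rewrite subr_lt0.
set x1 := x 1 0 in xx *; set x2 := x 2 0 in xx *.
set y1 := y 1 0 in yy *; set y2 := y 2 0 in yy *.
have lt : (x1 * y1 + x2 * y2) ^+ 2 < (x 0 0 * y 0 0) ^+ 2.
  have e1 : x 0 0 * x 0 0 = 1 + (x1 * x1 + x2 * x2) by lra.
  have e2 : 0 < y 0 0 * y 0 0 by rewrite mulr_gt0.
  have -> : (x 0 0 * y 0 0) ^+ 2 = (x 0 0 * x 0 0) * (y 0 0 * y 0 0) by ring.
  have n0 : 0 <= x1 * x1 + x2 * x2 by rewrite addr_ge0// -expr2 sqr_ge0.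
  have : (x1 * x1 + x2 * x2) * (y1 * y1 + y2 * y2) <=
         (x1 * x1 + x2 * x2) * (y 0 0 * y 0 0) by apply: ler_wpM2l => //; lra.
  have : 0 <= (x1 * y2 - x2 * y1) ^+ 2 by exact: sqr_ge0.
  rewrite e1; nra.
rewrite ltNge; apply: contraTN lt => le; rewrite -leNgt.
have xy0 : 0 <= x 0 0 * y 0 0 by rewrite ltW// mulr_gt0.
by rewrite ler_sqr// nnegrE (le_trans xy0).
Qed.

Definition frame x y z : 'M[R]_3 :=
  \matrix_(i < 3, j < 3) nth 0 [:: x i 0; y i 0; z i 0] j.

Lemma frameE x y z s :
  frame x y z *m s = s 0 0 *: x + (s 1 0 *: y + s 2 0 *: z).
Proof. by apply: eq3; rewrite mul3E !mxE /=; ring. Qed.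

Lemma frame_unit (P : 'M[R]_3) :
  (forall s t, lorentz (P *m s) (P *m t) = qform s t) -> P \in unitmx.
Proof.
move=> iso; rewrite -unitmx_tr -row_free_unit -kermx_eq0; apply/rowV0P => v.
move/sub_kermxP => /(congr1 trmx); rewrite trmx_mul trmxK trmx0 => Pv.
apply: trmx_inj; rewrite trmx0; move: v^T Pv => s Pv.
have q0 t : qform s t = 0 by rewrite -iso Pv /lorentz !mxE !mul0r addr0 subrr.
have := q0 (col3 1 0 0); have := q0 (col3 0 1 0); have := q0 (col3 0 0 1).
by rewrite /qform !mxE /= => a b c; apply: eq3; rewrite [RHS]mxE; lra.
Qed.

Lemma tangent_lorentz x y z : lorentz x x = -1 ->
  lorentz (tangent x y) (tangent x z) =
  lorentz y z + lorentz x y * lorentz x z.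
Proof.
move=> xx; have e : lorentz x x + 1 = 0 by lra.
rewrite /tangent; transitivity (lorentz y z + lorentz x y * lorentz x z +
  lorentz x y * lorentz x z * (lorentz x x + 1)).
  by rewrite /lorentz !mxE; ring.
by rewrite e mulr0 addr0.
Qed.

(** The angles determine the Gram matrix of [A], [B] and a multiple of [C],
    hence they place the triangle at the points [i], [e ^ (i theta)] and
    infinity of the upper half-plane, where [x + i y] is the symmetric matrix
    with rows [(x ^ 2 + y ^ 2, x) / y] and [(x, 1) / y]. *)
Lemma triangle_frame (theta : R) (A B C : 'cV[R]_3) :
  0 < theta -> theta < pi / 2 -> triangle_with_angles (pi / 2) theta A B C ->
  exists (P : 'M[R]_3) k, [/\ P \in unitmx,
    forall s t, lorentz (P *m s) (P *m t) = qform s t, k != 0 &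
    [/\ A = P *m col3 1 0 1, sin theta *: B = P *m col3 1 (cos theta) 1 &
        C = k *: (P *m col3 1 0 0)]].
Proof.
move=> th0 th1 [[[AA A0] [BB B0] [CC C0] _] []].
have sp : 0 < sin theta by apply: sin_gt0_pihalf; rewrite th0.
have cp : 0 < cos theta by apply: cos_gt0_pihalf; lra.
have ab : lorentz A B < 0 by apply: lorentz_lt0 => //; rewrite BB lerN10.
have ac : lorentz A C < 0 by apply: lorentz_lt0 => //; rewrite CC.
have bc : lorentz B C < 0 by apply: lorentz_lt0 => //; rewrite CC.
rewrite /angle !tangent_lorentz// AA BB CC (lorentzC B A) !add0r -!expr2 !sqrtr_sqr.
rewrite !ltr0_norm// ![-1 + _]addrC.
set x := lorentz A B in ab *; set y := lorentz A C in ac *.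
set z := lorentz B C in bc *; set r := Num.sqrt _.
move=> /cos_of_acos-/(_ (divr_gt0 (pi_gt0 _) (ltr0n _ 2))).
rewrite cos_pihalf => eA /cos_of_acos-/(_ th0) eB.
have r0 : r != 0.
  by apply: contraTneq cp => r0; rewrite eB r0 mul0r invr0 mulr0 ltxx.
have r2 : r ^+ 2 = x ^+ 2 - 1.
  rewrite sqr_sqrtr// leNgt; apply: contra r0 => /ltW h.
  by rewrite /r ler0_sqrtr.
have zE : z = - (x * y).
  move/esym/eqP: eA; rewrite mulf_eq0 invr_eq0 mulf_eq0 (negbTE r0) oppr_eq0.
  by rewrite (lt_eqF ac) !orbF => /eqP; lra.
have cE : cos theta = - r / x.
  rewrite eB zE; apply: (mulIf r0).
  have -> : - r / x * r = - r ^+ 2 / x by rewrite expr2; ring.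
  rewrite r2; field.
  by rewrite r0 !lt_eqF.
have sE : sin theta = - x^-1.
  have x0 : 0 < - x^-1 by rewrite oppr_gt0 invr_lt0.
  apply/eqP; rewrite -(eqrXn2 (ltn0Sn 1)) ?(ltW sp) ?(ltW x0)// sin2cos2 cE.
  rewrite exprMn sqrrN r2; apply/eqP; field.
  by rewrite lt_eqF.
set s := sin theta in sp sE *; set c := cos theta in cp cE *.
(* the images of the unit vectors of the space of symmetric matrices *)
pose c0 := (- (2 * y))^-1 *: C.
pose c1 := c^-1 *: (s *: B + (-1) *: A).
pose c2 := 1 *: A + (-1) *: c0.
have y0 : y != 0 by rewrite lt_eqF.
have x0 : x != 0 by rewrite lt_eqF.
have cn0 : c != 0 by rewrite gt_eqF.
have yE : (- (2 * y))^-1 * y = - (1 / 2) by field.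
have zE' : (- (2 * y))^-1 * z = x / 2 by rewrite zE; field.
have sx : s * x = -1 by rewrite sE mulNr mulVf.
have c2s2 : c ^+ 2 = 1 - s ^+ 2 by rewrite /c /s cos2sin2.
have CA : lorentz C A = y by rewrite lorentzC.
have CB : lorentz C B = z by rewrite lorentzC.
have BA : lorentz B A = x by rewrite lorentzC.
have g0A : lorentz c0 A = - (1 / 2).
  by rewrite lorentzZ CA yE.
have g0B : lorentz c0 B = x / 2.
  by rewrite lorentzZ CB zE'.
have g0C : lorentz c0 C = 0.
  by rewrite lorentzZ CC mulr0.
have g1A : lorentz c1 A = 0.
  by rewrite lorentzZ lorentz_comb BA AA sx mulrNN mulr1 addNr mulr0.
have g01 : lorentz c0 c1 = 0.
  rewrite lorentzC lorentzZ lorentz_comb ![lorentz _ c0]lorentzC g0A g0B.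
  have -> : s * (x / 2) + -1 * - (1 / 2) = (s * x + 1) / 2 by field.
  by rewrite sx addNr mul0r mulr0.
have g00 : lorentz c0 c0 = 0 by rewrite {1}/c0 lorentzZ lorentzC g0C mulr0.
have g02 : lorentz c0 c2 = - (1 / 2).
  by rewrite lorentzC lorentz_comb g00 lorentzC g0A; lra.
have g11 : lorentz c1 c1 = 1.
  rewrite {1}/c1 lorentzZ lorentz_comb ![lorentz _ c1]lorentzC g1A mulr0 addr0.
  rewrite lorentzZ lorentz_comb BB (_ : lorentz A B = x)//.
  have -> : s * (c^-1 * (s * -1 + -1 * x)) = - (s ^+ 2 + s * x) / c by field.
  rewrite sx; have -> : - (s ^+ 2 + -1) = c ^+ 2 by rewrite c2s2; ring.
  by field.
have g12 : lorentz c1 c2 = 0.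
  by rewrite lorentzC lorentz_comb g01 lorentzC g1A !mulr0 addr0.
have g22 : lorentz c2 c2 = 0.
  rewrite {1}/c2 lorentz_comb g02 [lorentz A c2]lorentzC lorentz_comb AA g0A; lra.
exists (frame c0 c1 c2), (- (2 * y)).
have iso u v : lorentz (frame c0 c1 c2 *m u) (frame c0 c1 c2 *m v) = qform u v.
  rewrite !frameE.
  rewrite lorentz_comb3 !(lorentzC _ (v 0 0 *: _ + _)) !lorentz_comb3.
  rewrite g00 g01 g02 g11 g12 g22 [lorentz c1 c0]lorentzC [lorentz c2 c0]lorentzC.
  by rewrite [lorentz c2 c1]lorentzC g01 g02 g12 /qform; field.
split=> //; first exact: frame_unit.
  by rewrite oppr_eq0 mulf_neq0.
rewrite !frameE !mxE /= !scale1r !scale0r !addr0 add0r; split.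
- by rewrite /c2 scale1r scaleN1r addrC subrK.
- have -> : c *: c1 = s *: B - A by rewrite /c1 scalerA mulfV// scale1r scaleN1r.
  rewrite /c2 scale1r scaleN1r.
  by apply: eq3; rewrite !mxE; ring.
- by rewrite /c0 scalerA mulfV ?scale1r// oppr_eq0 mulf_neq0.
Qed.
End Triangle.

(** * The triangle group and its hyperbolic classes *)

Section Group.
Context {R : realType}.

Lemma reflectionE (n x : 'cV[R]_3) :
  reflection n *m x = x - (2 * lorentz x n) *: n.
Proof. by apply: eq3; rewrite mul3E !mxE /lorentz !mxE /=; ring. Qed.

Lemma invmx_eq n (A B : 'M[R]_n) : A *m B = 1%:M -> invmx A = B.
Proof.
move=> AB; have [Au _] := mulmx1_unit AB.
by rewrite -[B](mulKmx Au) AB mulmx1.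
Qed.

Context (p : nat) (theta : R) (P : 'M[R]_3) (A B C : 'cV[R]_3) (k0 : R).
Hypotheses (p_ge6 : (6 <= p)%N) (p_theta : p%:R * theta = pi).
Hypothesis P_unit : P \in unitmx.
Hypothesis P_iso : forall s t, lorentz (P *m s) (P *m t) = qform s t.
Hypotheses (k0_neq0 : k0 != 0) (sin_neq0 : sin theta != 0).
Hypothesis cos_neq0 : cos theta != 0.
Hypothesis A_eq : A = P *m col3 1 0 1.
Hypothesis B_eq : sin theta *: B = P *m col3 1 (cos theta) 1.
Hypothesis C_eq : C = k0 *: (P *m col3 1 0 0).

Implicit Types (l h : seq int) (g x y : 'M[R]_3) (s t m : 'cV[R]_3).

(** Matrices of determinant [-1] whose symmetric squares are the reflections
    in the unit circle, the imaginary axis and the line of real part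
    [cos theta] of the upper half-plane. *)
Definition mirror_AB : 'M[R]_2 := mat2 0 1 1 0.
Definition mirror_CA : 'M[R]_2 := mat2 (-1) 0 0 1.
Definition mirror_BC : 'M[R]_2 := mat2 (-1) (2 * cos theta) 0 1.

Let perp (X : 'cV[R]_3) (e : 'cV[R]_3) :=
  forall m, lorentz (P *m m) X = 0 <-> qform m e = 0.

Let perp_scale a X e : a != 0 -> a *: X = P *m e -> perp X e.
Proof.
move=> a0 Xe m; have : lorentz (P *m m) (a *: X) = qform m e by rewrite Xe P_iso.
rewrite lorentzC lorentzZ lorentzC => <-; split=> [->|/eqP]; first exact: mulr0.
by rewrite mulf_eq0 (negbTE a0) => /eqP.
Qed.

Let perpA : perp A (col3 1 0 1).
Proof. by apply: (@perp_scale 1); rewrite ?oner_neq0// scale1r. Qed.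

Let perpB : perp B (col3 1 (cos theta) 1).
Proof. exact: perp_scale B_eq. Qed.

Let perpC : perp C (col3 1 0 0).
Proof.
apply: (@perp_scale k0^-1); rewrite ?invr_eq0//.
by rewrite C_eq scalerA mulVf// scale1r.
Qed.

Let reflections_throughE X Y (e f m : 'cV[R]_3) (M : 'M[R]_2) :
  perp X e -> perp Y f -> qform m m = 1 -> qform m e = 0 -> qform m f = 0 ->
  (forall s, qform s e = 0 -> qform s f = 0 -> exists a, s = a *: m) ->
  (forall s, sym2 M *m s = s - (2 * qform s m) *: m) ->
  reflections_through X Y = [set isometry P M]%classic.
Proof.
move=> Xe Yf mm me mf uniq Mm.
have refl a : a * a = 1 -> reflection (P *m (a *: m)) = isometry P M.
  move=> aa; apply: mx_ext => x; have [s ->] := frame_coord P_unit x.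
  rewrite isometryE// reflectionE P_iso Mm mulmxBr -!scalemxAr !scalerA.
  congr (_ - _ *: _); rewrite (_ : qform s (a *: m) = a * qform s m).
    by rewrite -[RHS]mul1r -aa; ring.
  by rewrite /qform !mxE; field.
apply/seteqP; split=> [g [n []]|_ ->] /=.
  have [s ->] := frame_coord P_unit n.
  rewrite P_iso => ss /Xe se /Yf sf <-; have [a sa] := uniq s se sf.
  rewrite sa refl//; rewrite -ss sa.
  have -> : qform (a *: m) (a *: m) = a * a * qform m m.
    by rewrite /qform !mxE; field.
  by rewrite mm mulr1.
exists (P *m m); first by split; [rewrite P_iso|apply/Xe|apply/Yf].
by rewrite -[m]scale1r refl// mulr1.
Qed.

Lemma reflections_AB : reflections_through A B = [set isometry P mirror_AB]%classic.
Proof.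
apply: (reflections_throughE (m := col3 1 0 (-1)) perpA perpB);
  rewrite /qform ?mxE /=; [by field|by field|by field| |].
- move=> s; rewrite ?mxE /= => e1 e2; exists (s 0 0).
  have s2 : s 2 0 = - s 0 0 by lra.
  have s1 : s 1 0 = 0 by apply: (mulIf cos_neq0); lra.
  by apply: eq3; rewrite !mxE /= ?s1 ?s2; ring.
- by move=> s; rewrite sym2E; apply: eq3; rewrite !mxE /=; field.
Qed.

Lemma reflections_CA : reflections_through C A = [set isometry P mirror_CA]%classic.
Proof.
apply: (reflections_throughE (m := col3 0 1 0) perpC perpA);
  rewrite /qform ?mxE /=; [by field|by field|by field| |].
- move=> s; rewrite ?mxE /= => e1 e2; exists (s 1 0).
  by apply: eq3; rewrite !mxE /=; lra.
- by move=> s; rewrite sym2E; apply: eq3; rewrite !mxE /=; field.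
Qed.

Lemma reflections_BC : reflections_through B C = [set isometry P mirror_BC]%classic.
Proof.
apply: (reflections_throughE (m := col3 (2 * cos theta) 1 0) perpB perpC);
  rewrite /qform ?mxE /=; [by field|by field|by field| |].
- move=> s; rewrite ?mxE /= => e1 e2; exists (s 1 0).
  by apply: eq3; rewrite !mxE /=; lra.
- by move=> s; rewrite sym2E; apply: eq3; rewrite !mxE /=; field.
Qed.

Notation F l := (isometry P (word theta l)).
Notation J := (isometry P mirror_AB).
Notation G := (triangle_group A B C).

Lemma F_cat l h : F (l ++ h) = F l *m F h.
Proof. by rewrite word_cat isometryM. Qed.

Lemma F_nil : F [::] = 1%:M. Proof. exact: isometry1. Qed.

Lemma F_E l h : F l = F h <-> sym2 (word theta l) = sym2 (word theta h).
Proof.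
by split; [exact: isometry_inj|exact: eq_isometry].
Qed.

Lemma F_winvr l : F l *m F (winv l) = 1%:M.
Proof.
rewrite -F_cat -F_nil; apply/F_E.
by rewrite (E_cat theta) (E_winvr p_ge6 p_theta) (E_nil theta).
Qed.

Lemma F_winv l : F (winv l) *m F l = 1%:M.
Proof. exact/mulmx1C/F_winvr. Qed.

Lemma J2 : J *m J = 1%:M.
Proof.
rewrite -isometryM// -(isometry1 P_unit); congr isometry.
by apply: eq2; rewrite mul2E !mxE /=; ring.
Qed.

(** The reflection in the mirror [A B] normalises the rotation subgroup. *)
Lemma JF l : J *m F l = F (map -%R l) *m J.
Proof.
elim: l => [|k l IH] /=; first by rewrite !F_nil mulmx1 mul1mx.
rewrite !isometryM// mulmxA -(isometryM P_unit mirror_AB).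
have -> : mirror_AB *m syl theta k = (- syl theta (- k)) *m mirror_AB.
  have e1 : - k + 1 = - (k - 1) by lia.
  have e2 : - k - 1 = - (k + 1) by lia.
  by apply: eq2; rewrite !mul2E !mxE /= ?e1 ?e2 !chordN; ring.
by rewrite isometryM// isometryN -(mulmxA _ J (F l)) IH mulmxA.
Qed.

Lemma mirror_CAE : isometry P mirror_CA = F [:: 0] *m J.
Proof.
rewrite -isometryM// -isometryN; congr isometry.
rewrite /= mulmx1 (syl0 p_ge6 p_theta).
by apply: eq2; rewrite !mul2E !mxE /=; ring.
Qed.

Lemma mirror_BCE : isometry P mirror_BC = F [:: 1; 0] *m J.
Proof.
rewrite -isometryM// -isometryN; congr isometry.
rewrite /= mulmx1 (syl0 p_ge6 p_theta) (syl_first p_ge6 p_theta).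
rewrite (chord_2 p_ge6 p_theta).
by apply: eq2; rewrite !mul2E !mxE /=; ring.
Qed.

Let H : set 'M[R]_3 := [set g | exists l, g = F l \/ g = F l *m J]%classic.

Let H_subgroup : is_subgroup H.
Proof.
have inv l : invmx (F l) = F (winv l) by apply: invmx_eq; exact: F_winvr.
have invJ l : invmx (F l *m J) = F (map -%R (winv l)) *m J.
  apply: invmx_eq; rewrite -JF mulmxA -(mulmxA (F l)) J2 mulmx1; exact: F_winvr.
split.
- move=> _ [l [] ->].
    by have [] := mulmx1_unit (F_winvr l).
  by rewrite unitmx_mul (mulmx1_unit (F_winvr l)).1 (mulmx1_unit J2).1.
- by exists [::]; left; rewrite F_nil.
- move=> _ _ [l [] ->] [h [] ->].
  + by exists (l ++ h); left; rewrite F_cat.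
  + by exists (l ++ h); right; rewrite F_cat mulmxA.
  + by exists (l ++ map -%R h); right; rewrite F_cat -!mulmxA JF.
  + exists (l ++ map -%R h); left.
    by rewrite F_cat -!mulmxA; congr (_ *m _); rewrite mulmxA JF -mulmxA J2 mulmx1.
- move=> _ [l [] ->]; first by exists (winv l); left.
  by exists (map -%R (winv l)); right.
Qed.

(** The reflection in [A B] normalises the group of the words, and the two
    other reflections are the words [[:: 0]] and [[:: 1; 0]] followed by it;
    hence the reflection group consists of the words and of the words followed
    by this reflection, and the determinant tells which ones occur. *)
Lemma triangle_groupP g : G g <-> exists l, g = F l.
Proof.
rewrite /triangle_group /generated_group reflections_AB reflections_BC reflections_CA.
split=> [[gG]|[l ->]].
  have /= [|l [-> _|->]] := gG H.
  - split; first exact: H_subgroup.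
    move=> x [[|]|] ->.
    + by exists [::]; right; rewrite F_nil mul1mx.
    + by exists [:: 1; 0]; right; exact: mirror_BCE.
    + by exists [:: 0]; right; exact: mirror_CAE.
  - by exists l.
  - rewrite /orientation_preserving det_mulmx !(det_isometry P_unit).
    rewrite (det_word p_ge6 p_theta) det2E !mxE /= => neg; exfalso.
    move: neg; rewrite !(mul0r, mul1r, sub0r, expr1n, mulr1) exprS sqrrN expr1n; lra.
split; last first.
  rewrite /orientation_preserving (det_isometry P_unit).
  by rewrite (det_word p_ge6 p_theta) expr1n.
move=> K [[Kunit K1 Kmul Kinv] Ksub].
have KJ : K J by apply: Ksub; left; left.
have KBC : K (isometry P mirror_BC) by apply: Ksub; left; right.
have KCA : K (isometry P mirror_CA) by apply: Ksub; right.
have KF0 : K (F [:: 0]).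
  have -> : F [:: 0] = isometry P mirror_CA *m J.
    by rewrite mirror_CAE -mulmxA J2 mulmx1.
  exact: Kmul.
have KF1 : K (F [:: 1]).
  have -> : F [:: 1] = isometry P mirror_BC *m isometry P mirror_CA.
    have JF0 : J *m F [:: 0] = F [:: 0] *m J by rewrite JF /= oppr0.
    rewrite mirror_BCE mirror_CAE -JF0 -(mulmxA (F [:: 1; 0])) (mulmxA J J) J2.
    rewrite mul1mx -F_cat; apply/F_E.
    rewrite (_ : _ ++ _ = [:: 1] ++ [:: 0; 0])// (E_cat theta).
    by rewrite (E_00 p_ge6 p_theta) mulmx1.
  exact: Kmul.
have KFn (n : nat) : K (F [:: n%:Z]).
  elim: n => [//|n IH].
  have -> : F [:: n.+1%:Z] = F [:: n%:Z] *m F [:: 0] *m F [:: 1].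
    rewrite -!F_cat; apply/F_E.
    by rewrite [_ ++ _]/= (E_merge p_ge6 p_theta) -PoszD addn1.
  by apply/Kmul => //; exact: Kmul.
elim: l => [|k l IH]; first by rewrite F_nil.
rewrite -cat1s F_cat; apply/Kmul => //.
have -> : F [:: k] = F [:: `|(k %% p%:Z)%Z|%N%:Z].
  apply/F_E; rewrite (E_modp p_ge6 p_theta) gez0_abs// modz_ge0//.
  by clear -p_ge6; lia.
exact: KFn.
Qed.

(** Conjugacy stated without inverses, as an intertwining relation. *)
Lemma conj_classP g x : conj_class G g x <-> exists h, x *m F h = F h *m g.
Proof.
split=> [[_ /triangle_groupP[h ->] <-]|[h xh]].
  by exists h; rewrite -mulmxA (invmx_eq (F_winvr h)) F_winv mulmx1.
exists (F h); first by apply/triangle_groupP; exists h.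
by rewrite -xh -mulmxA (invmx_eq (F_winvr h)) F_winvr mulmx1.
Qed.

Lemma conj_class_eq g x : conj_class G g x -> conj_class G x = conj_class G g.
Proof.
move=> /conj_classP[h xh]; apply/seteqP; split=> y /conj_classP[a ya];
  apply/conj_classP.
- by exists (a ++ h); rewrite F_cat mulmxA ya -mulmxA xh mulmxA.
- exists (a ++ winv h); rewrite F_cat mulmxA ya -!mulmxA; congr (_ *m _).
  rewrite -[g](mul1mx g) -(F_winv h) -[in LHS](mulmxA _ (F h)) -xh.
  by rewrite -!mulmxA F_winvr mulmx1.
Qed.

Lemma hyperbolic_syl k : 2 <= k <= p%:Z - 2 -> hyperbolic (F [:: k]) /\
  hlength (F [:: k]) = 2 * arccosh (chord theta k).
Proof.
move=> kmid.
have [ck ck1 ck2] : [/\ chord theta 2 <= chord theta k,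
    chord theta 1 <= chord theta (k + 1) & chord theta 1 <= chord theta (k - 1)].
  by split; apply: (chord_mono p_ge6 p_theta); clear -kmid; lia.
have c2 := chord2_gt1 p_ge6 p_theta; rewrite (chord1 p_ge6 p_theta) in ck1 ck2.
have d1 := det_syl p_ge6 p_theta k.
have tr : \tr (syl theta k) = 2 * chord theta k by rewrite tr2E !mxE /=; ring.
have k1 : 1 <= chord theta k by lra.
have k2 : 1 <= chord theta k ^+ 2 by rewrite exprn_ege1.
rewrite /= mulmx1; split.
  by apply: hyperbolic_balanced => //; rewrite !mxE //=; lra.
rewrite hlength_balanced//; [|rewrite tr exprMn; lra|by rewrite !mxE| |];
  try by (rewrite !mxE /=; lra).
rewrite -arccosh_double// tr; congr arccosh.
by field.
Qed.

Lemma hlength_long l : 2 * chord theta 3 <= \tr (word theta l) ->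
  2 * arccosh (chord theta 3) <= hlength (F l).
Proof.
have c2 := chord2_gt1 p_ge6 p_theta; have c3 := chord2_lt_chord3 p_ge6 p_theta.
move=> tr; have t2 : (2 * chord theta 3) ^+ 2 <= \tr (word theta l) ^+ 2.
  by rewrite ler_sqr// nnegrE; lra.
have k2 : 1 <= chord theta 3 ^+ 2 by rewrite exprn_ege1//; lra.
rewrite exprMn in t2.
have hl : 4 <= (\tr (word theta l)) ^+ 2 by lra.
apply: le_trans (hlength_ge P_unit P_iso (det_word p_ge6 p_theta l) hl).
rewrite -arccosh_double; last lra.
by apply: ler_arccosh; lra.
Qed.

(** The exponent sums of [[:: 2]] and [[:: p - 2]] differ by [4] modulo [p],
    so these mutually inverse classes, of the same length, are different. *)
Lemma classes_neq : conj_class G (F [:: 2]) <> conj_class G (F [:: p%:Z - 2]).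
Proof.
move=> e; have : conj_class G (F [:: 2]) (F [:: 2]).
  by apply/conj_classP; exists [::]; rewrite F_nil mul1mx mulmx1.
rewrite e => /conj_classP[h]; rewrite -!F_cat => /F_E/(wsum_eq p_ge6 p_theta).
rewrite !wsum_cat !wsum_cons wsum_nil.
rewrite (_ : 2 + 0 + wsum h - (wsum h + (p%:Z - 2 + 0)) = 4 - p%:Z); last by ring.
rewrite rpredBr ?dvdzz// dvdzE !absz_nat => /(dvdn_leq (ltn0Sn 3)).
by rewrite leqNgt (leq_trans _ p_ge6).
Qed.

Lemma hyperbolic_class_cases c : hyperbolic_classes G c ->
  [\/ c = conj_class G (F [:: 2]), c = conj_class G (F [:: p%:Z - 2])
    | exists2 g, c g & 2 * arccosh (chord theta 3) <= hlength g].
Proof.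
move=> [g [/triangle_groupP[l ->] hyp] <-].
have := hyperbolic_trace P_unit P_iso (det_word p_ge6 p_theta l) hyp.
move=> /(word_trace p_ge6 p_theta)[l' [h [lh cases]]].
have mem : conj_class G (F l) (F l').
  apply/conj_classP; exists (winv h).
  have /F_E : sym2 (word theta (l ++ h)) = sym2 (word theta (h ++ l')).
    by rewrite !word_cat !sym2M.
  rewrite !F_cat => lh'.
  rewrite -[F l']mul1mx -(F_winv h) -[X in X *m F (winv h)]mulmxA -lh'.
  by rewrite -!mulmxA F_winvr mulmx1.
rewrite -(conj_class_eq mem).
case: cases => [->|->|long]; [exact: Or31|exact: Or32|apply: Or33].
exists (F l'); last exact: hlength_long.
by apply/conj_classP; exists [::]; rewrite F_nil mul1mx mulmx1.
Qed.

End Group.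

(** Two entries [L] and all others at least [L' > L], attained, force the
    first three values of a nondecreasing enumeration. *)
Lemma sorted_prefix (R : realType) (lam : nat -> R) (L L' : R) (i j k : nat) :
  {homo lam : m n / (m <= n)%N >-> m <= n} -> i <> j ->
  lam i = L -> lam j = L -> lam k = L' -> L < L' ->
  (forall n, [\/ n = i, n = j | L' <= lam n]) ->
  [/\ lam 0%N = L, lam 1%N = L & lam 2%N = L'].
Proof.
move=> homo ij li lj lk LL cases.
have low n : lam n < L' -> n = i \/ n = j.
  by move=> lt; case: (cases n) => [|| le]; [left|right|rewrite ltNge le in lt].
have valL n : lam n < L' -> lam n = L by move=> /low[] ->.
have l0 : lam 0%N < L' by apply: le_lt_trans (homo 0%N i _) _; rewrite ?li.
have l1 : lam 1%N < L'.
  have [i0|i0] := posnP i.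
    by apply: le_lt_trans (homo 1%N j _) _; rewrite ?lj//; lia.
  by apply: le_lt_trans (homo 1%N i _) _; rewrite ?li.
have l2 : L' <= lam 2%N.
  rewrite leNgt; apply/negP => /low; move: (low _ l0) (low _ l1); lia.
have k2 : (2 <= k)%N.
  case: k lk => [|[|//]] lk; [move: l0|move: l1]; by rewrite lk ltxx.
split; [exact: valL|exact: valL|].
by apply/le_anti; rewrite l2 -lk homo.
Qed.

Unset Implicit Arguments.

Theorem mainTheorem4 (R : realType) (p : nat) (A B C : 'cV[R]_3)
    (lam : nat -> R)
    (hp : (6 <= p <= 10)%N)
    (hT : triangle_with_angles (pi / 2) (pi / p%:R) A B C)
    (hlam : is_length_spectrum (triangle_group A B C) lam) :
  [/\ lam 0%N = lam 1%N,
      lam 1%N = 2 * arccosh (2 * cos (pi / p%:R)),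
      lam 1%N < lam 2%N
    & lam 2%N = 2 * arccosh (4 * cos (pi / p%:R) ^+ 2 - 1)].
Proof.
have p_ge6 : (6 <= p)%N by case/andP: hp.
have p_theta : p%:R * (pi / p%:R) = pi :> R.
  by rewrite mulrC divfK// pnatr_eq0; lia.
move: (pi / p%:R) p_theta hT => theta p_theta hT.
have th0 := theta_gt0 p_ge6 p_theta; have th1 := theta_lt p_ge6 p_theta.
have thlt : theta < pi / 2 by lra.
have sin0 : sin theta != 0 by rewrite gt_eqF// sin_gt0_pihalf// th0.
have cos0 : cos theta != 0.
  by rewrite gt_eqF//; apply: cos_gt0_pihalf; lra.
have [P [k [Pu Pi k0 [AE BE CE]]]] := triangle_frame th0 thlt hT.
have [homo [c [[cfun cinj csurj] clen]]] := hlam.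
have groupP := triangle_groupP p_ge6 p_theta Pu Pi k0 sin0 cos0 AE BE CE.
have sylP := hyperbolic_syl p_ge6 p_theta Pu Pi.
have refl g : triangle_group A B C g -> conj_class (triangle_group A B C) g g.
  move=> _; exists 1%:M; last by rewrite mul1mx invmx1 mulmx1.
  by apply/groupP; exists [::]; rewrite isometry1.
have index j : 2 <= j <= p%:Z - 2 -> exists2 n,
    c n = conj_class (triangle_group A B C) (isometry P (word theta [:: j]))
    & lam n = 2 * arccosh (chord theta j).
  move=> jmid; have [hyp len] := sylP j jmid.
  have Gj : triangle_group A B C (isometry P (word theta [:: j])).
    by apply/groupP; exists [:: j].
  have [|n _ cn] := csurj (conj_class (triangle_group A B C)
    (isometry P (word theta [:: j]))).
    by exists (isometry P (word theta [:: j])).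
  by exists n => //; rewrite -len; apply: clen; rewrite cn; exact: refl.
have [|i1 c1 l1] := index 2; first by clear -p_ge6; lia.
have [|i2 c2 l2] := index (p%:Z - 2); first by clear -p_ge6; lia.
have [|i3 c3 l3] := index 3; first by clear -p_ge6; lia.
have chp : chord theta (p%:Z - 2) = chord theta 2.
  by rewrite addrC (chordDp p_theta) chordN opprK.
rewrite chp in l2.
have gt1 := chord2_gt1 p_ge6 p_theta.
have lt23 : 2 * arccosh (chord theta 2) < 2 * arccosh (chord theta 3).
  rewrite ltr_pM2l//; apply: ltr_arccosh; first lra.
  exact: chord2_lt_chord3 p_ge6 p_theta.
have i12 : i1 <> i2.
  move=> e; apply: (classes_neq p_ge6 p_theta Pu Pi k0 sin0 cos0 AE BE CE).
  by rewrite -c1 -c2 e.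
have cases n : [\/ n = i1, n = i2 | 2 * arccosh (chord theta 3) <= lam n].
  have inj n' : c n = c n' -> n = n' by move=> e; apply: cinj; rewrite ?inE.
  have := hyperbolic_class_cases p_ge6 p_theta Pu Pi k0 sin0 cos0 AE BE CE (cfun n I).
  case=> [e|e|[g cg le]].
  - by apply: Or31; apply: inj; rewrite c1.
  - by apply: Or32; apply: inj; rewrite c2.
  - by apply: Or33; rewrite (clen n g cg).
have [e0 e1 e2] := sorted_prefix homo i12 l1 l2 l3 lt23 cases.
rewrite -(chord_3 p_ge6 p_theta) -(chord_2 p_ge6 p_theta).
by split; rewrite ?e0 ?e1 ?e2.
Qed.
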